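(* Let $\mathcal{A}=\mathbb{C}\langle s,s^*\mid s^*s=1\rangle$ be the unital $*$-algebra generated by an element $s$ subject to the single relation $s^*s=1$, and let $\pi_0$ be the $*$-representation of $\mathcal{A}$ on $l^2(\mathbb{N}_0)$ determined by $\pi_0(s)=S$, where $S$ is the unilateral shift. For any $x=x^*\in\mathcal{A}$ the following are equivalent: (i) $x=y^*y$ for some $y\in\mathcal{A}$; (ii) $\pi(x)\geq 0$ for every $*$-representation $\pi$ of $\mathcal{A}$ on a Hilbert space; (iii) $\pi_0(x)\geq 0$ on $l^2(\mathbb{N}_0)$. Moreover, if these hold, then $y$ in (i) can be chosen so that the matrix of $\pi_0(y)$ with respect to the standard orthonormal basis $\{e_k\}_{k\in\mathbb{N}_0}$ of $l^2(\mathbb{N}_0)$ is lower-triangular.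
   Context: The unilateral shift is $S(\varphi_0,\varphi_1,\varphi_2,\dots)=(0,\varphi_0,\varphi_1,\dots)$ on $l^2(\mathbb{N}_0)$, i.e. $Se_k=e_{k+1}$. A $*$-representation of a unital $*$-algebra on a Hilbert space $\mathcal{H}$ means a unit-preserving $*$-homomorphism into the bounded operators $\mathcal{B}(\mathcal{H})$. A matrix $(m_{ij})_{i,j\ge 0}$ is lower-triangular if $m_{ij}=0$ whenever $j>i$. *)

(* Defs.v *)
From Stdlib Require Import Reals.
Open Scope R_scope.

Record C : Type := mkC { Cre : R; Cim : R }.
Definition C0 : C := mkC 0 0.
Definition C1 : C := mkC 1 0.
Definition Cadd (a b : C) : C := mkC (Cre a + Cre b) (Cim a + Cim b).
Definition Copp (a : C) : C := mkC (- Cre a) (- Cim a).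
Definition Cmul (a b : C) : C :=
  mkC (Cre a * Cre b - Cim a * Cim b) (Cre a * Cim b + Cim a * Cre b).
Definition Cconj (a : C) : C := mkC (Cre a) (- Cim a).
Definition Cnorm2 (a : C) : R := Cre a * Cre a + Cim a * Cim a.

(* inner product linear in the first argument, conjugate-linear in the second *)
Record HilbertSpace : Type := {
  hs_car :> Type;
  hs_zero : hs_car;
  hs_add : hs_car -> hs_car -> hs_car;
  hs_opp : hs_car -> hs_car;
  hs_scal : C -> hs_car -> hs_car;
  hs_inner : hs_car -> hs_car -> C;
  hs_addA : forall u v w, hs_add u (hs_add v w) = hs_add (hs_add u v) w;
  hs_addC : forall u v, hs_add u v = hs_add v u;
  hs_add0 : forall u, hs_add u hs_zero = u;
  hs_addN : forall u, hs_add u (hs_opp u) = hs_zero;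
  hs_scal1 : forall u, hs_scal C1 u = u;
  hs_scalA : forall a b u, hs_scal a (hs_scal b u) = hs_scal (Cmul a b) u;
  hs_scalDr : forall a u v, hs_scal a (hs_add u v) = hs_add (hs_scal a u) (hs_scal a v);
  hs_scalDl : forall a b u, hs_scal (Cadd a b) u = hs_add (hs_scal a u) (hs_scal b u);
  hs_innerDl : forall u v w,
      hs_inner (hs_add u v) w = Cadd (hs_inner u w) (hs_inner v w);
  hs_innerZl : forall a u w, hs_inner (hs_scal a u) w = Cmul a (hs_inner u w);
  hs_innerC : forall u v, hs_inner v u = Cconj (hs_inner u v);
  hs_inner_pos : forall u, 0 <= Cre (hs_inner u u);
  hs_inner_def : forall u, hs_inner u u = C0 -> u = hs_zero;
  hs_complete : forall f : nat -> hs_car,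
      (forall eps, 0 < eps -> exists N, forall m n, (N <= m)%nat -> (N <= n)%nat ->
         sqrt (Cre (hs_inner (hs_add (f m) (hs_opp (f n))) (hs_add (f m) (hs_opp (f n))))) < eps) ->
      exists l, forall eps, 0 < eps -> exists N, forall n, (N <= n)%nat ->
         sqrt (Cre (hs_inner (hs_add (f n) (hs_opp l)) (hs_add (f n) (hs_opp l)))) < eps
}.

Arguments hs_zero {h}.
Arguments hs_add {h}.
Arguments hs_opp {h}.
Arguments hs_scal {h}.
Arguments hs_inner {h}.

Definition hs_norm {H : HilbertSpace} (v : H) : R := sqrt (Cre (hs_inner v v)).

Definition bounded_op (H : HilbertSpace) (T : H -> H) : Prop :=
  (forall u v, T (hs_add u v) = hs_add (T u) (T v)) /\
  (forall a u, T (hs_scal a u) = hs_scal a (T u)) /\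
  (exists M, forall v, hs_norm (T v) <= M * hs_norm v).

Definition pos_op (H : HilbertSpace) (T : H -> H) : Prop :=
  forall v : H, Cim (hs_inner (T v) v) = 0 /\ 0 <= Cre (hs_inner (T v) v).

Inductive term : Type :=
| tS : term
| t1 : term
| t0 : term
| tadd : term -> term -> term
| tscal : C -> term -> term
| tmul : term -> term -> term
| tstar : term -> term.

(* the congruence generated by the unital *-algebra axioms and s* s = 1;
   A is term modulo eqA *)
Inductive eqA : term -> term -> Prop :=
| eqA_refl : forall a, eqA a a
| eqA_sym : forall a b, eqA a b -> eqA b a
| eqA_trans : forall a b c, eqA a b -> eqA b c -> eqA a c
| eqA_add : forall a a' b b', eqA a a' -> eqA b b' -> eqA (tadd a b) (tadd a' b')
| eqA_scal : forall c a a', eqA a a' -> eqA (tscal c a) (tscal c a')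
| eqA_mul : forall a a' b b', eqA a a' -> eqA b b' -> eqA (tmul a b) (tmul a' b')
| eqA_star : forall a a', eqA a a' -> eqA (tstar a) (tstar a')
| eqA_addA : forall a b c, eqA (tadd a (tadd b c)) (tadd (tadd a b) c)
| eqA_addC : forall a b, eqA (tadd a b) (tadd b a)
| eqA_add0 : forall a, eqA (tadd a t0) a
| eqA_addN : forall a, eqA (tadd a (tscal (Copp C1) a)) t0
| eqA_scal1 : forall a, eqA (tscal C1 a) a
| eqA_scalA : forall c d a, eqA (tscal c (tscal d a)) (tscal (Cmul c d) a)
| eqA_scalDr : forall c a b, eqA (tscal c (tadd a b)) (tadd (tscal c a) (tscal c b))
| eqA_scalDl : forall c d a, eqA (tscal (Cadd c d) a) (tadd (tscal c a) (tscal d a))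
| eqA_mulA : forall a b c, eqA (tmul a (tmul b c)) (tmul (tmul a b) c)
| eqA_mul1l : forall a, eqA (tmul t1 a) a
| eqA_mul1r : forall a, eqA (tmul a t1) a
| eqA_mulDl : forall a b c, eqA (tmul (tadd a b) c) (tadd (tmul a c) (tmul b c))
| eqA_mulDr : forall a b c, eqA (tmul a (tadd b c)) (tadd (tmul a b) (tmul a c))
| eqA_mulZl : forall k a b, eqA (tmul (tscal k a) b) (tscal k (tmul a b))
| eqA_mulZr : forall k a b, eqA (tmul a (tscal k b)) (tscal k (tmul a b))
| eqA_starK : forall a, eqA (tstar (tstar a)) a
| eqA_starD : forall a b, eqA (tstar (tadd a b)) (tadd (tstar a) (tstar b))
| eqA_starZ : forall k a, eqA (tstar (tscal k a)) (tscal (Cconj k) (tstar a))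
| eqA_starM : forall a b, eqA (tstar (tmul a b)) (tmul (tstar b) (tstar a))
| eqA_star1 : eqA (tstar t1) t1
| eqA_rel : eqA (tmul (tstar tS) tS) t1.

(* *-representation of A on a Hilbert space H (unit-preserving, into B(H)),
   given on representatives and required to be well defined on the quotient *)
Definition star_rep (H : HilbertSpace) (pi : term -> H -> H) : Prop :=
  (forall a b, eqA a b -> forall v, pi a v = pi b v) /\
  (forall v, pi t1 v = v) /\
  (forall v, pi t0 v = hs_zero) /\
  (forall a b v, pi (tadd a b) v = hs_add (pi a v) (pi b v)) /\
  (forall c a v, pi (tscal c a) v = hs_scal c (pi a v)) /\
  (forall a b v, pi (tmul a b) v = pi a (pi b v)) /\
  (forall a u v, hs_inner (pi (tstar a) u) v = hs_inner u (pi a v)) /\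
  (forall a, bounded_op H (pi a)).

Definition cseq := nat -> C.

Definition in_l2 (phi : cseq) : Prop :=
  exists l, infinite_sum (fun n => Cnorm2 (phi n)) l.

Definition shift (phi : cseq) : cseq :=
  fun n => match n with O => C0 | S k => phi k end.
Definition shift_adj (phi : cseq) : cseq := fun n => phi (S n).

(* pi_0 computed together with pi_0 of the adjoint *)
Fixpoint pi0p (t : term) : (cseq -> cseq) * (cseq -> cseq) :=
  match t with
  | tS => (shift, shift_adj)
  | t1 => (fun phi => phi, fun phi => phi)
  | t0 => (fun _ _ => C0, fun _ _ => C0)
  | tadd a b =>
      let (A, A') := pi0p a in let (B, B') := pi0p b in
      (fun phi n => Cadd (A phi n) (B phi n), fun phi n => Cadd (A' phi n) (B' phi n))
  | tscal c a =>
      let (A, A') := pi0p a in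
      (fun phi n => Cmul c (A phi n), fun phi n => Cmul (Cconj c) (A' phi n))
  | tmul a b =>
      let (A, A') := pi0p a in let (B, B') := pi0p b in
      (fun phi => A (B phi), fun phi => B' (A' phi))
  | tstar a => let (A, A') := pi0p a in (A', A)
  end.

Definition pi0 (t : term) : cseq -> cseq := fst (pi0p t).

Definition pos_on_l2 (T : cseq -> cseq) : Prop :=
  forall phi, in_l2 phi ->
    (exists r, 0 <= r /\
       infinite_sum (fun n => Cre (Cmul (T phi n) (Cconj (phi n)))) r) /\
    infinite_sum (fun n => Cim (Cmul (T phi n) (Cconj (phi n)))) 0.

Definition e_basis (k : nat) : cseq := fun n => if Nat.eqb n k then C1 else C0.

(* matrix of pi_0(y): m_ij = <pi_0(y) e_j, e_i> = (pi_0(y) e_j)_i *)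
Definition lower_triangular (T : cseq -> cseq) : Prop :=
  forall i j : nat, (i < j)%nat -> T (e_basis j) i = C0.

(* Main.v *)
From Stdlib Require Import Reals Lra Lia Setoid Morphisms.
From Stdlib Require Import FunctionalExtensionality ProofIrrelevance.
From Coquelicot Require Import Rbar Lim_seq Hierarchy.
Require Import Defs.
Open Scope R_scope.

(** The implication from (iii) to (i) is an infinite Cholesky factorization started at
    infinity.  The matrix [M] of [pi0 x] is Hermitian, positive semidefinite, banded and
    Toeplitz up to a finite corner.  Eliminating the coordinates [m+k-1, ..., m] from its
    leading block of size [m+k] gives Hermitian forms on [C^m] that decrease with [k];
    their limit [schur M m] is the Schur complement of [M] on the first [m] coordinates.
    Since infima commute, [schur M m] arises from [schur M (m+1)] by eliminating one more
    coordinate, i.e. by subtracting a rank one form [r_m^* r_m].  The rows [r_m] make up a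
    lower-triangular [Y] with [Y^* Y = M], by telescoping.  Elimination respects bands and
    shifts, so [Y] is again banded and Toeplitz up to a finite corner, and such matrices
    are exactly the [pi0 y]; this also yields the Fejer-Riesz factorization of the symbol
    instead of requiring it.  Faithfulness of [pi0] then gives [x = y^* y]. *)

(** * Complex numbers and finite sums *)

Declare Scope cplx_scope.
Delimit Scope cplx_scope with K.
Bind Scope cplx_scope with C.
Infix "+" := Cadd : cplx_scope.
Infix "*" := Cmul : cplx_scope.
Notation "- x" := (Copp x) : cplx_scope.
Definition Csub (a b : C) : C := (a + - b)%K.
Infix "-" := Csub : cplx_scope.
Definition RtoC (r : R) : C := mkC r 0.
Definition Ci : C := mkC 0 1.

Lemma C_ext (a b : C) : Cre a = Cre b -> Cim a = Cim b -> a = b.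
Proof. destruct a, b; simpl; intros; subst; reflexivity. Qed.

Ltac C_solve :=
  intros; apply C_ext;
  unfold Csub, RtoC, Ci, C0, C1, Cadd, Cmul, Copp, Cconj; simpl; try ring.

Lemma C_ring : ring_theory C0 C1 Cadd Cmul Csub Copp eq.
Proof. constructor; C_solve. Qed.
Add Ring C_ring : C_ring.

Lemma Cconj_add a b : Cconj (a + b) = (Cconj a + Cconj b)%K. Proof. C_solve. Qed.
Lemma Cconj_mul a b : Cconj (a * b) = (Cconj a * Cconj b)%K. Proof. C_solve. Qed.
Lemma Cconj_sub a b : Cconj (a - b) = (Cconj a - Cconj b)%K. Proof. C_solve. Qed.
Lemma Cconj_invol a : Cconj (Cconj a) = a. Proof. C_solve. Qed.
Lemma Cconj_RtoC r : Cconj (RtoC r) = RtoC r. Proof. C_solve. Qed.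
Lemma Cconj_0 : Cconj C0 = C0. Proof. C_solve. Qed.
Lemma Cconj_1 : Cconj C1 = C1. Proof. C_solve. Qed.

Lemma Cmul_conj_self a : (Cconj a * a)%K = RtoC (Cnorm2 a).
Proof. unfold Cnorm2; C_solve. Qed.

Lemma Cnorm2_pos a : 0 <= Cnorm2 a.
Proof. unfold Cnorm2; nra. Qed.

Lemma Cnorm2_eq0 a : Cnorm2 a = 0 -> a = C0.
Proof.
  unfold Cnorm2; intro H; pose proof (Rle_0_sqr (Cre a)) as H1;
  pose proof (Rle_0_sqr (Cim a)) as H2; unfold Rsqr in *.
  apply C_ext; simpl; apply Rsqr_0_uniq; unfold Rsqr; lra.
Qed.

Fixpoint Csum (f : nat -> C) (n : nat) : C :=
  match n with O => C0 | S k => (Csum f k + f k)%K end.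

Lemma Csum_ext f g n : (forall i, (i < n)%nat -> f i = g i) -> Csum f n = Csum g n.
Proof.
  induction n; simpl; intro H; [reflexivity|].
  rewrite IHn, H by (intros; auto with arith); reflexivity.
Qed.

Lemma Csum_0 f n : (forall i, (i < n)%nat -> f i = C0) -> Csum f n = C0.
Proof.
  induction n; simpl; intro H; [reflexivity|].
  rewrite IHn, H by (intros; auto with arith); ring.
Qed.

Lemma Csum_add f g n : Csum (fun i => (f i + g i)%K) n = (Csum f n + Csum g n)%K.
Proof. induction n; simpl; [|rewrite IHn]; ring. Qed.

Lemma Csum_mul_l c f n : Csum (fun i => (c * f i)%K) n = (c * Csum f n)%K.
Proof. induction n; simpl; [|rewrite IHn]; ring. Qed.

Lemma Csum_mul_r c f n : Csum (fun i => (f i * c)%K) n = (Csum f n * c)%K.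
Proof. induction n; simpl; [|rewrite IHn]; ring. Qed.

Lemma Csum_conj f n : Cconj (Csum f n) = Csum (fun i => Cconj (f i)) n.
Proof. induction n; simpl; [apply Cconj_0|rewrite Cconj_add, IHn; reflexivity]. Qed.

Lemma Csum_swap (f : nat -> nat -> C) m n :
  Csum (fun i => Csum (f i) n) m = Csum (fun j => Csum (fun i => f i j) m) n.
Proof.
  induction m; simpl.
  - symmetry; apply Csum_0; reflexivity.
  - rewrite IHm, Csum_add; reflexivity.
Qed.

Lemma Csum_single f n j :
  (j < n)%nat -> (forall i, (i < n)%nat -> i <> j -> f i = C0) -> Csum f n = f j.
Proof.
  induction n; simpl; intros Hj H; [lia|].
  destruct (Nat.eq_dec j n) as [->|Hne].
  - rewrite Csum_0 by (intros; apply H; lia); ring.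
  - rewrite IHn, (H n) by (intros; try apply H; lia); ring.
Qed.

Lemma Csum_extend f n p :
  (n <= p)%nat -> (forall i, (n <= i < p)%nat -> f i = C0) -> Csum f p = Csum f n.
Proof.
  induction 1 as [|p Hp IH]; intro H; [reflexivity|].
  simpl; rewrite IH, H by (intros; try apply H; lia); ring.
Qed.

Lemma e_basis_same k : e_basis k k = C1.
Proof. unfold e_basis; rewrite Nat.eqb_refl; reflexivity. Qed.

Lemma e_basis_other k n : n <> k -> e_basis k n = C0.
Proof. unfold e_basis; intro H; apply Nat.eqb_neq in H; rewrite H; reflexivity. Qed.

(** * Schur complements of semidefinite matrices *)

Definition sform (m : nat) (A : nat -> nat -> C) (u v : nat -> C) : C :=
  Csum (fun i => Csum (fun j => (Cconj (u i) * A i j * v j)%K) m) m.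

Definition qform m A u : R := Cre (sform m A u u).

Definition herm (A : nat -> nat -> C) := forall i j, A i j = Cconj (A j i).
Definition psd m A := forall u, 0 <= qform m A u.

Definition pivot (A : nat -> nat -> C) m : R := Cre (A m m).

(* Schur complement of the last diagonal entry of the leading block of size
   [m+1].  A vanishing pivot is harmless: then [/ 0 = 0] and nothing is
   subtracted, and for a positive semidefinite block row [m] vanishes too. *)
Definition elim m (A : nat -> nat -> C) : nat -> nat -> C :=
  fun i j => (A i j - A i m * A m j * RtoC (/ pivot A m))%K.

Definition upd (u : nat -> C) m c : nat -> C := fun i => if Nat.eqb i m then c else u i.

Definition lastrow m (A : nat -> nat -> C) (u : nat -> C) : C :=
  Csum (fun j => (A m j * u j)%K) m.

Lemma upd_same u m c : upd u m c m = c.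
Proof. unfold upd; rewrite Nat.eqb_refl; reflexivity. Qed.

Lemma upd_other u m c i : (i < m)%nat -> upd u m c i = u i.
Proof. unfold upd; intro H; rewrite (proj2 (Nat.eqb_neq i m)) by lia; reflexivity. Qed.

Lemma sform_ext m A B u v u' v' :
  (forall i j, (i < m)%nat -> (j < m)%nat -> A i j = B i j) ->
  (forall i, (i < m)%nat -> u i = u' i) -> (forall i, (i < m)%nat -> v i = v' i) ->
  sform m A u v = sform m B u' v'.
Proof.
  intros HA Hu Hv; apply Csum_ext; intros i Hi; apply Csum_ext; intros j Hj.
  rewrite HA, Hu, Hv by assumption; reflexivity.
Qed.

Lemma lastrow_upd m A u c : lastrow m A (upd u m c) = lastrow m A u.
Proof. apply Csum_ext; intros; rewrite upd_other by assumption; reflexivity. Qed.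

Lemma herm_diag A m : herm A -> A m m = RtoC (pivot A m).
Proof.
  intro H; apply C_ext; [reflexivity|]; simpl.
  pose proof (f_equal Cim (H m m)) as E; simpl in E; lra.
Qed.

Lemma sform_succ m A u :
  herm A ->
  sform (S m) A u u =
  (sform m A u u + (Cconj (u m) * lastrow m A u + Cconj (lastrow m A u) * u m)
   + RtoC (pivot A m * Cnorm2 (u m)))%K.
Proof.
  intro H; unfold sform; simpl.
  rewrite Csum_add.
  replace (Csum (fun i => (Cconj (u i) * A i m * u m)%K) m)
    with (Cconj (lastrow m A u) * u m)%K.
  2:{ unfold lastrow; rewrite Csum_conj, <- Csum_mul_r; apply Csum_ext; intros.
      rewrite Cconj_mul, <- H; ring. }
  replace (Csum (fun j => (Cconj (u m) * A m j * u j)%K) m)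
    with (Cconj (u m) * lastrow m A u)%K.
  2:{ unfold lastrow; rewrite <- Csum_mul_l; apply Csum_ext; intros; ring. }
  replace (RtoC (pivot A m * Cnorm2 (u m))) with (A m m * (Cconj (u m) * u m))%K.
  2:{ rewrite Cmul_conj_self, herm_diag by assumption; C_solve. }
  ring.
Qed.

(** The subtracted matrix has rank one: by hermiticity [A i m] is the conjugate of [A m i], so its
    double sum splits into [lastrow] times its conjugate, over the pivot. *)
Lemma sform_elim m A u :
  herm A ->
  sform m (elim m A) u u =
  (sform m A u u - RtoC (Cnorm2 (lastrow m A u) * / pivot A m))%K.
Proof.
  intro H.
  replace (RtoC (Cnorm2 (lastrow m A u) * / pivot A m))
    with (Cconj (lastrow m A u) * lastrow m A u * RtoC (/ pivot A m))%K.
  2:{ rewrite Cmul_conj_self; C_solve. }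
  transitivity (sform m A u u + RtoC (-1) * (Cconj (lastrow m A u) * lastrow m A u * RtoC (/ pivot A m)))%K.
  2:{ C_solve. }
  unfold sform, lastrow at 1; rewrite Csum_conj, <- !Csum_mul_r, <- Csum_mul_l, <- Csum_add.
  apply Csum_ext; intros i _.
  unfold lastrow; rewrite <- !Csum_mul_l, <- Csum_mul_r, <- Csum_mul_l, <- Csum_add.
  apply Csum_ext; intros j _.
  unfold elim; rewrite Cconj_mul, <- H; C_solve.
Qed.

Lemma qform_succ m A u c :
  herm A ->
  qform (S m) A (upd u m c) =
  qform m A u + 2 * Cre (Cconj c * lastrow m A u) + pivot A m * Cnorm2 c.
Proof.
  intro H; unfold qform; rewrite sform_succ, lastrow_upd, upd_same by assumption.
  rewrite (sform_ext m A A (upd u m c) (upd u m c) u u)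
    by (intros; try rewrite upd_other by assumption; reflexivity).
  simpl; ring.
Qed.

Lemma qform_elim m A u :
  herm A -> qform m (elim m A) u = qform m A u - Cnorm2 (lastrow m A u) * / pivot A m.
Proof. intro H; unfold qform; rewrite sform_elim by assumption; simpl; ring. Qed.

Lemma psd_pivot_pos m A : herm A -> psd (S m) A -> 0 <= pivot A m.
Proof.
  intros H P; pose proof (P (upd (fun _ => C0) m C1)) as Q.
  rewrite qform_succ in Q by assumption.
  unfold qform, lastrow, sform in Q.
  rewrite !Csum_0 in Q.
  - unfold Cnorm2 in Q; simpl in Q; lra.
  - intros; ring.
  - intros; apply Csum_0; intros; ring.
Qed.

(** With a zero pivot the form is affine along the last coordinate [- t * l], with slope
    [- 2 * Cnorm2 l]; it stays nonnegative for all [t] only if [l] vanishes. *)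
Lemma psd_pivot_0 m A u :
  herm A -> psd (S m) A -> pivot A m = 0 -> lastrow m A u = C0.
Proof.
  intros H P E; apply Cnorm2_eq0.
  set (l := lastrow m A u).
  assert (Q : forall t, 0 <= qform m A u - 2 * t * Cnorm2 l).
  { intro t; pose proof (P (upd u m (RtoC (- t) * l)%K)) as Q.
    rewrite qform_succ, E in Q by assumption; fold l in Q.
    unfold Cnorm2; simpl in Q |- *; lra. }
  pose proof (Cnorm2_pos l) as Hl.
  destruct (Req_dec (Cnorm2 l) 0) as [|Hn]; [assumption|exfalso].
  (* This [t] makes the affine function equal to [-1]. *)
  pose proof (Q ((qform m A u + 1) / (2 * Cnorm2 l))) as Q1.
  replace (2 * ((qform m A u + 1) / (2 * Cnorm2 l)) * Cnorm2 l) with (qform m A u + 1)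
    in Q1 by (field; assumption).
  lra.
Qed.

(** Completing the square: for a pivot [p > 0] and [l = lastrow m A u] the gap is
    [p * Cnorm2 (c + l / p)]. Together with [elim_attained], whose witness is [c = - l / p], this
    makes elimination the minimum of the form over the last coordinate. *)
Lemma elim_le m A u c :
  herm A -> psd (S m) A -> qform m (elim m A) u <= qform (S m) A (upd u m c).
Proof.
  intros H P; rewrite qform_succ, qform_elim by assumption.
  pose proof (psd_pivot_pos m A H P) as Hp.
  destruct (Req_dec (pivot A m) 0) as [E|E].
  - rewrite (psd_pivot_0 m A u H P E), E; unfold Cnorm2; simpl; lra.
  - set (l := lastrow m A u); set (p := pivot A m) in *.
    assert (p * Cnorm2 (c + RtoC (/ p) * l)%K
            = p * Cnorm2 c + 2 * Cre (Cconj c * l)%K + Cnorm2 l * / p) as K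
      by (unfold Cnorm2; simpl; field; assumption).
    pose proof (Cnorm2_pos (c + RtoC (/ p) * l)%K); nra.
Qed.

Lemma elim_attained m A u :
  herm A -> psd (S m) A ->
  exists c, qform m (elim m A) u = qform (S m) A (upd u m c).
Proof.
  intros H P; exists (RtoC (- / pivot A m) * lastrow m A u)%K.
  rewrite qform_succ, qform_elim by assumption.
  destruct (Req_dec (pivot A m) 0) as [E|E].
  - rewrite (psd_pivot_0 m A u H P E), E; unfold Cnorm2; simpl; ring.
  - unfold Cnorm2; simpl; field; assumption.
Qed.

Lemma elim_herm m A : herm A -> herm (elim m A).
Proof.
  intros H i j; unfold elim.
  rewrite Cconj_sub, !Cconj_mul, <- !H, Cconj_RtoC; ring.
Qed.

Lemma elim_psd m A : herm A -> psd (S m) A -> psd m (elim m A).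
Proof. intros H P u; destruct (elim_attained m A u H P) as [c ->]; apply P. Qed.

(** Minima of ordered functions are ordered: both forms are compared at the minimizer for [B]. *)
Lemma elim_mono m A B :
  herm A -> herm B -> psd (S m) A -> psd (S m) B ->
  (forall u, qform (S m) A u <= qform (S m) B u) ->
  forall u, qform m (elim m A) u <= qform m (elim m B) u.
Proof.
  intros HA HB PA PB L u; destruct (elim_attained m B u HB PB) as [c ->].
  eapply Rle_trans; [apply elim_le; assumption|apply L].
Qed.

(** The inner call starts at [S m], so coordinates are removed from the outside in, [m+k-1] first
    and [m] last. Consecutive [k] thus share their outer eliminations and can be compared by
    [elim_mono]. *)
Fixpoint elims m k (A : nat -> nat -> C) : nat -> nat -> C :=
  match k with O => A | S k => elim m (elims (S m) k A) end.

Lemma elims_herm m k A : herm A -> herm (elims m k A).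
Proof. revert m; induction k; simpl; intros; [|apply elim_herm]; auto. Qed.

Lemma elims_psd m k A : herm A -> (forall p, psd p A) -> psd m (elims m k A).
Proof.
  intros H P; revert m; induction k; intro m; simpl; [apply P|].
  apply elim_psd; [apply elims_herm; assumption|apply IHk].
Qed.

(** For [k = 0] the minimum over the new coordinate is at most the value at [0]. This inequality,
    taken at a larger [m], is then carried inward by [elim_mono]. *)
Lemma elims_decr m k A u :
  herm A -> (forall p, psd p A) ->
  qform m (elims m (S k) A) u <= qform m (elims m k A) u.
Proof.
  intros H P; revert m u; induction k; intros m u.
  - simpl; eapply Rle_trans; [apply (elim_le m A u C0); auto|].
    rewrite qform_succ by assumption; unfold Cnorm2; simpl; lra.
  - apply (elim_mono m (elims (S m) (S k) A) (elims (S m) k A)).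
    1, 2: apply elims_herm; assumption.
    1, 2: apply elims_psd; assumption.
    apply IHk.
Qed.

(** * Polarization: a Hermitian form determines its matrix *)

Lemma sform_add_l m A u u' v :
  sform m A (fun i => u i + u' i)%K v = (sform m A u v + sform m A u' v)%K.
Proof.
  unfold sform; rewrite <- Csum_add; apply Csum_ext; intros; rewrite <- Csum_add.
  apply Csum_ext; intros; rewrite Cconj_add; ring.
Qed.

Lemma sform_add_r m A u v v' :
  sform m A u (fun i => v i + v' i)%K = (sform m A u v + sform m A u v')%K.
Proof.
  unfold sform; rewrite <- Csum_add; apply Csum_ext; intros; rewrite <- Csum_add.
  apply Csum_ext; intros; ring.
Qed.

Lemma sform_mul_r m A u c v : sform m A u (fun i => c * v i)%K = (c * sform m A u v)%K.
Proof.
  unfold sform; rewrite <- Csum_mul_l; apply Csum_ext; intros; rewrite <- Csum_mul_l.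
  apply Csum_ext; intros; ring.
Qed.

Lemma sform_conj m A u v : herm A -> sform m A u v = Cconj (sform m A v u).
Proof.
  intro H; unfold sform; rewrite Csum_conj, Csum_swap; apply Csum_ext; intros.
  rewrite Csum_conj; apply Csum_ext; intros.
  rewrite !Cconj_mul, Cconj_invol, (H i0 i); ring.
Qed.

Lemma sform_e m A i j : (i < m)%nat -> (j < m)%nat -> sform m A (e_basis i) (e_basis j) = A i j.
Proof.
  intros Hi Hj; unfold sform; rewrite (Csum_single _ m i); [|assumption|].
  - rewrite (Csum_single _ m j); [|assumption|].
    + rewrite !e_basis_same, Cconj_1; ring.
    + intros; rewrite (e_basis_other j) by assumption; ring.
  - intros; apply Csum_0; intros.
    rewrite (e_basis_other i) by assumption; rewrite Cconj_0; ring.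
Qed.

(** The scalar [c] selects the part of the entry: [C1] yields the real part, and [Ci] or [- Ci] the
    imaginary part up to sign. *)
Lemma qform_polar m A c i j :
  herm A -> (i < m)%nat -> (j < m)%nat ->
  2 * Cre (c * A i j) =
  qform m A (fun p => e_basis i p + c * e_basis j p)%K
  - qform m A (e_basis i) - qform m A (fun p => c * e_basis j p)%K.
Proof.
  intros H Hi Hj; unfold qform.
  rewrite sform_add_l, !sform_add_r.
  rewrite (sform_conj m A (fun p => c * e_basis j p)%K (e_basis i)) by assumption.
  rewrite !(sform_mul_r m A (e_basis i)), !sform_e by assumption; cbn [Cre Cim Cadd Cmul Cconj]; ring.
Qed.

Lemma qform_inj m A B i j :
  herm A -> herm B -> (forall u, qform m A u = qform m B u) ->
  (i < m)%nat -> (j < m)%nat -> A i j = B i j.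
Proof.
  intros HA HB E Hi Hj.
  pose proof (qform_polar m A C1 i j HA Hi Hj) as A1.
  pose proof (qform_polar m A Ci i j HA Hi Hj) as A2.
  pose proof (qform_polar m B C1 i j HB Hi Hj) as B1.
  pose proof (qform_polar m B Ci i j HB Hi Hj) as B2.
  rewrite !E in A1, A2; simpl in *; apply C_ext; lra.
Qed.

(** A total limit, with a meaningless value for divergent sequences, so that [schur] needs no
    convergence proof; [is_Clim] carries the convergence. *)
Definition Clim (z : nat -> C) : C :=
  mkC (real (Lim_seq (fun k => Cre (z k)))) (real (Lim_seq (fun k => Cim (z k)))).

Definition is_Clim (z : nat -> C) (l : C) :=
  is_lim_seq (fun k => Cre (z k)) (Cre l) /\ is_lim_seq (fun k => Cim (z k)) (Cim l).

Definition schur (M : nat -> nat -> C) m : nat -> nat -> C :=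
  fun i j => Clim (fun k => elims m k M i j).

Lemma is_Clim_const c : is_Clim (fun _ => c) c.
Proof. split; apply is_lim_seq_const. Qed.

Lemma is_Clim_add x y a b :
  is_Clim x a -> is_Clim y b -> is_Clim (fun k => x k + y k)%K (a + b)%K.
Proof. intros [H1 H2] [H3 H4]; split; simpl; apply is_lim_seq_plus'; assumption. Qed.

Lemma is_Clim_mul x y a b :
  is_Clim x a -> is_Clim y b -> is_Clim (fun k => x k * y k)%K (a * b)%K.
Proof.
  intros [H1 H2] [H3 H4]; split; simpl.
  - apply is_lim_seq_minus'; apply is_lim_seq_mult'; assumption.
  - apply is_lim_seq_plus'; apply is_lim_seq_mult'; assumption.
Qed.

Lemma is_Clim_sum (z : nat -> nat -> C) l n :
  (forall i, (i < n)%nat -> is_Clim (fun k => z k i) (l i)) ->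
  is_Clim (fun k => Csum (z k) n) (Csum l n).
Proof.
  induction n; simpl; intro H; [apply is_Clim_const|].
  apply is_Clim_add; auto with arith.
Qed.

(** * Limits of Schur complements and the triangular factor *)

Section Schur.
Variable M : nat -> nat -> C.
Hypothesis M_herm : herm M.
Hypothesis M_psd : forall m, psd m M.

Let eh m k : herm (elims m k M) := elims_herm m k M M_herm.
Let ep m k : psd m (elims m k M) := elims_psd m k M M_herm M_psd.

Lemma elims_qform_cvg m u : ex_finite_lim_seq (fun k => qform m (elims m k M) u).
Proof.
  apply ex_finite_lim_seq_decr with 0.
  - intro k; apply elims_decr; assumption.
  - intro k; apply ep.
Qed.

Lemma elims_entry_cvg m c i j :
  (i < m)%nat -> (j < m)%nat -> ex_finite_lim_seq (fun k => Cre (c * elims m k M i j)).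
Proof.
  intros Hi Hj.
  destruct (elims_qform_cvg m (fun p => e_basis i p + c * e_basis j p)%K) as [a Ha].
  destruct (elims_qform_cvg m (e_basis i)) as [b Hb].
  destruct (elims_qform_cvg m (fun p => c * e_basis j p)%K) as [d Hd].
  exists (/ 2 * (a - b - d)).
  eapply is_lim_seq_ext.
  2:{ apply is_lim_seq_mult'; [apply is_lim_seq_const|].
      apply is_lim_seq_minus'; [apply is_lim_seq_minus'|]; eassumption. }
  intro k; simpl.
  pose proof (qform_polar m _ c i j (eh m k) Hi Hj) as E; simpl in E; lra.
Qed.

Lemma schur_lim m i j :
  (i < m)%nat -> (j < m)%nat -> is_Clim (fun k => elims m k M i j) (schur M m i j).
Proof.
  intros Hi Hj; split; simpl; apply Lim_seq_correct'.
  - destruct (elims_entry_cvg m C1 i j Hi Hj) as [l Hl]; exists l.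
    eapply is_lim_seq_ext, Hl; intro; simpl; ring.
  - destruct (elims_entry_cvg m (- Ci) i j Hi Hj) as [l Hl]; exists l.
    eapply is_lim_seq_ext, Hl; intro; simpl; ring.
Qed.

(** [herm] ranges over all indices, also those outside the block where convergence is not
    established. It still holds there, because [Lim_seq] commutes with negation unconditionally and
    [real] sends both infinities to [0]. *)
Lemma schur_herm m : herm (schur M m).
Proof.
  intros i j; apply C_ext; simpl.
  - f_equal; apply Lim_seq_ext; intro k; rewrite (eh m k i j); reflexivity.
  - erewrite Lim_seq_ext.
    2:{ intro k; rewrite (eh m k i j); simpl; reflexivity. }
    rewrite Lim_seq_opp.
    destruct (Lim_seq (fun k => Cim (elims m k M j i))); simpl; ring.
Qed.

Lemma schur_qform m u :
  is_lim_seq (fun k => qform m (elims m k M) u) (qform m (schur M m) u).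
Proof.
  apply (is_Clim_sum (fun k i => Csum (fun j => (Cconj (u i) * elims m k M i j * u j)%K) m)).
  intros i Hi; apply (is_Clim_sum (fun k j => (Cconj (u i) * elims m k M i j * u j)%K)).
  intros j Hj; repeat apply is_Clim_mul; try apply is_Clim_const.
  apply schur_lim; assumption.
Qed.

Lemma schur_le m k u : qform m (schur M m) u <= qform m (elims m k M) u.
Proof.
  apply (is_lim_seq_decr_compare _ _ (schur_qform m u)).
  intro; apply elims_decr; assumption.
Qed.

Lemma schur_psd m : psd m (schur M m).
Proof.
  intro u; apply (is_lim_seq_le (fun _ => 0) (fun k => qform m (elims m k M) u) 0
                    (qform m (schur M m) u)).
  - intro; apply ep.
  - apply is_lim_seq_const.
  - apply schur_qform.
Qed.

(** The infimum over [k] commutes with the minimum over coordinate [m]. For one inequality, the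
    minimizer [c] of the limit form is tested at every stage [k] before passing to the limit. For
    the other, the minimizer of stage [k] is tested in the limit form, which lies below stage
    [k]. *)
Lemma schur_step_qform m u :
  qform m (schur M m) u = qform m (elim m (schur M (S m))) u.
Proof.
  apply Rle_antisym.
  - destruct (elim_attained m _ u (schur_herm (S m)) (schur_psd (S m))) as [c ->].
    apply (is_lim_seq_le (fun k => qform m (elims m (S k) M) u)
             (fun k => qform (S m) (elims (S m) k M) (upd u m c))
             (qform m (schur M m) u) (qform (S m) (schur M (S m)) (upd u m c))).
    + intro k; apply elim_le; [apply eh|apply ep].
    + apply (is_lim_seq_incr_1 (fun k => qform m (elims m k M) u)), schur_qform.
    + apply schur_qform.
  - apply (is_lim_seq_le (fun _ => qform m (elim m (schur M (S m))) u)
             (fun k => qform m (elims m (S k) M) u)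
             (qform m (elim m (schur M (S m))) u) (qform m (schur M m) u)).
    + intro k; simpl.
      destruct (elim_attained m _ u (eh (S m) k) (ep (S m) k)) as [c ->].
      eapply Rle_trans; [apply elim_le with (c := c); [apply schur_herm|apply schur_psd]|].
      apply schur_le.
    + apply is_lim_seq_const.
    + apply (is_lim_seq_incr_1 (fun k => qform m (elims m k M) u)), schur_qform.
Qed.

Lemma schur_step m i j :
  (i < m)%nat -> (j < m)%nat -> schur M m i j = elim m (schur M (S m)) i j.
Proof.
  apply qform_inj; [apply schur_herm|apply elim_herm, schur_herm|apply schur_step_qform].
Qed.

(** Row [m] of the factor: the last row of the Schur complement of size [m+1], scaled so that its
    rank one form is exactly what [elim m] subtracts. At a zero pivot the scaling factor is
    [/ 0 = 0] and the row vanishes. *)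
Definition factor m j : C :=
  if (j <=? m)%nat
  then (schur M (S m) m j * RtoC (/ sqrt (pivot (schur M (S m)) m)))%K
  else C0.

Let piv_pos m : 0 <= pivot (schur M (S m)) m.
Proof. apply psd_pivot_pos; [apply schur_herm|apply schur_psd]. Qed.

Lemma factor_mul m i j :
  (i <= m)%nat -> (j <= m)%nat ->
  (Cconj (factor m i) * factor m j =
   schur M (S m) i m * schur M (S m) m j * RtoC (/ pivot (schur M (S m)) m))%K.
Proof.
  intros Hi Hj; unfold factor.
  rewrite (proj2 (Nat.leb_le i m) Hi), (proj2 (Nat.leb_le j m) Hj).
  rewrite Cconj_mul, <- schur_herm, Cconj_RtoC.
  replace (RtoC (/ pivot (schur M (S m)) m))
    with (RtoC (/ sqrt (pivot (schur M (S m)) m)) * RtoC (/ sqrt (pivot (schur M (S m)) m)))%K.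
  - ring.
  - rewrite <- (sqrt_sqrt _ (piv_pos m)) at 3; rewrite Rinv_mult; C_solve.
Qed.

(** The rank one form already accounts for all of row [m], so eliminating [m] leaves nothing there.
    A nonzero pivot cancels; at a zero pivot both sides vanish, since semidefiniteness kills the
    row. *)
Lemma schur_row_pivot m j :
  (j <= m)%nat ->
  (schur M (S m) m m * schur M (S m) m j * RtoC (/ pivot (schur M (S m)) m)
   = schur M (S m) m j)%K.
Proof.
  intro Hj; set (A := schur M (S m)).
  assert (HA : herm A) by apply schur_herm.
  rewrite (herm_diag A m) by assumption.
  destruct (Req_dec (pivot A m) 0) as [E|E].
  - replace (A m j) with C0; [ring|].
    destruct (Nat.eq_dec j m) as [->|Hn].
    + rewrite (herm_diag A m), E by assumption; reflexivity.
    + pose proof (psd_pivot_0 m A (e_basis j) HA (schur_psd (S m)) E) as K.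
      unfold lastrow in K; rewrite (Csum_single _ m j) in K.
      * rewrite e_basis_same in K; rewrite <- K; ring.
      * lia.
      * intros; rewrite e_basis_other by assumption; ring.
  - apply C_ext; simpl; field; assumption.
Qed.

(** Row [m] contributes the Schur complement of size [m+1] minus that of size [m] padded with zeros:
    inside the smaller block this is [schur_step], in row and column [m] it is [schur_row_pivot]. *)
Lemma factor_telescope L i j :
  Csum (fun k => (Cconj (factor k i) * factor k j)%K) L =
  if andb (i <? L)%nat (j <? L)%nat then schur M L i j else C0.
Proof.
  induction L as [|m IH].
  - simpl; reflexivity.
  - simpl Csum; rewrite IH.
    destruct (Nat.ltb_spec i (S m)) as [Hi|Hi]; destruct (Nat.ltb_spec j (S m)) as [Hj|Hj]; simpl.
    + rewrite factor_mul by lia.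
      destruct (Nat.ltb_spec i m) as [Hi'|Hi']; destruct (Nat.ltb_spec j m) as [Hj'|Hj']; simpl.
      * rewrite schur_step by assumption; unfold elim; ring.
      * replace j with m by lia.
        (* Column [m] is turned into the conjugate of row [m], where [schur_row_pivot] applies. *)
        rewrite (schur_herm (S m) i m).
        replace (Cconj (schur M (S m) m i)) with
          (Cconj (schur M (S m) m m * schur M (S m) m i * RtoC (/ pivot (schur M (S m)) m)))%K at 2
          by (f_equal; apply schur_row_pivot; lia).
        rewrite !Cconj_mul, Cconj_RtoC, <- (schur_herm (S m) m m); ring.
      * replace i with m by lia; rewrite schur_row_pivot by lia; ring.
      * replace i with m by lia; rewrite schur_row_pivot by lia; ring.
    + unfold factor at 2; rewrite (proj2 (Nat.leb_gt j m)) by lia.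
      rewrite (proj2 (Nat.ltb_ge j m)), Bool.andb_false_r by lia; ring.
    + unfold factor at 1; rewrite (proj2 (Nat.leb_gt i m)) by lia.
      rewrite (proj2 (Nat.ltb_ge i m)) by lia; rewrite Cconj_0; simpl; ring.
    + unfold factor at 1; rewrite (proj2 (Nat.leb_gt i m)) by lia.
      rewrite (proj2 (Nat.ltb_ge i m)) by lia; rewrite Cconj_0; simpl; ring.
Qed.

(** * Band and Toeplitz structure of the factor *)

Variable K : nat.
Hypothesis M_band : forall i j, (i + K <= j \/ j + K <= i)%nat -> M i j = C0.
Hypothesis M_toep : forall i j, (K <= i)%nat -> (K <= j)%nat -> M (S i) (S j) = M i j.

(** Every correction contains an entry linking [i] or [j] to an eliminated coordinate at or beyond
    [m], hence an entry outside the band. *)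
Lemma elims_band m k i j : (i + K <= m \/ j + K <= m)%nat -> elims m k M i j = M i j.
Proof.
  revert m i j; induction k; intros m i j H; simpl; [reflexivity|].
  unfold elim; rewrite (IHk (S m) i j) by lia.
  destruct H as [H|H].
  - rewrite (IHk (S m) i m), (M_band i m) by lia; ring.
  - rewrite (IHk (S m) m j), (M_band m j) by lia; ring.
Qed.

(** Each elimination step reads only entries with indices among [i], [j] and the pivot index. All of
    these are at least [K], where a diagonal shift changes nothing. *)
Lemma elims_toep m k i j :
  (K <= m)%nat -> (K <= i)%nat -> (K <= j)%nat ->
  elims (S m) k M (S i) (S j) = elims m k M i j.
Proof.
  revert m i j; induction k; intros m i j Hm Hi Hj; simpl; [auto|].
  unfold elim, pivot; rewrite !IHk by lia; reflexivity.
Qed.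

Lemma schur_band m i j : (i + K <= m \/ j + K <= m)%nat -> schur M m i j = M i j.
Proof.
  intro H; unfold schur, Clim.
  apply C_ext; simpl;
    (erewrite Lim_seq_ext; [rewrite Lim_seq_const; reflexivity|]);
    intro k; simpl; rewrite elims_band by assumption; reflexivity.
Qed.

Lemma schur_toep m i j :
  (K <= m)%nat -> (K <= i)%nat -> (K <= j)%nat ->
  schur M (S m) (S i) (S j) = schur M m i j.
Proof.
  intros; unfold schur, Clim; f_equal; f_equal; apply Lim_seq_ext; intro;
    rewrite elims_toep by assumption; reflexivity.
Qed.

Lemma factor_upper m j : (m < j)%nat -> factor m j = C0.
Proof. intro H; unfold factor; rewrite (proj2 (Nat.leb_gt j m) H); reflexivity. Qed.

Lemma factor_band m j : (j + K <= m)%nat -> factor m j = C0.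
Proof.
  intro H; unfold factor; rewrite (proj2 (Nat.leb_le j m)) by lia.
  rewrite schur_band, M_band by lia; ring.
Qed.

Lemma factor_toep m j :
  (K <= m)%nat -> (K <= j)%nat -> factor (S m) (S j) = factor m j.
Proof.
  intros Hm Hj; unfold factor, pivot; cbn [Nat.leb].
  destruct (j <=? m)%nat; [|reflexivity].
  rewrite !schur_toep by lia; reflexivity.
Qed.

(** Once [L] is beyond [i + K], the Schur complement no longer differs from [M] at this entry, so
    the telescoped sum is [M i j] itself and no limit in [L] is taken. *)
Lemma factor_gram L i j :
  (i + j + K < L)%nat -> Csum (fun k => (Cconj (factor k i) * factor k j)%K) L = M i j.
Proof.
  intro H; rewrite factor_telescope.
  rewrite (proj2 (Nat.ltb_lt i L)), (proj2 (Nat.ltb_lt j L)) by lia; simpl.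
  apply schur_band; lia.
Qed.

End Schur.

(** * The algebra and its faithful representation *)

Lemma eqA_Equivalence : Equivalence eqA.
Proof.
  split; [exact eqA_refl|exact eqA_sym|exact eqA_trans].
Qed.
Global Existing Instance eqA_Equivalence.

Global Instance tadd_Proper : Proper (eqA ==> eqA ==> eqA) tadd.
Proof. intros a a' Ha b b' Hb; apply eqA_add; assumption. Qed.
Global Instance tmul_Proper : Proper (eqA ==> eqA ==> eqA) tmul.
Proof. intros a a' Ha b b' Hb; apply eqA_mul; assumption. Qed.
Global Instance tscal_Proper c : Proper (eqA ==> eqA) (tscal c).
Proof. intros a a' Ha; apply eqA_scal; assumption. Qed.
Global Instance tstar_Proper : Proper (eqA ==> eqA) tstar.
Proof. intros a a' Ha; apply eqA_star; assumption. Qed.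

Lemma tscal_0 a : eqA (tscal C0 a) t0.
Proof.
  replace C0 with (C1 + - C1)%K by ring.
  rewrite eqA_scalDl, eqA_scal1; apply eqA_addN.
Qed.

Lemma tscal_t0 c : eqA (tscal c t0) t0.
Proof.
  rewrite <- (tscal_0 t1) at 1; rewrite eqA_scalA.
  replace (c * C0)%K with C0 by ring; apply tscal_0.
Qed.

Lemma tmul_0_l a : eqA (tmul t0 a) t0.
Proof. rewrite <- (tscal_0 t1) at 1; rewrite eqA_mulZl; apply tscal_0. Qed.

Lemma tmul_0_r a : eqA (tmul a t0) t0.
Proof. rewrite <- (tscal_0 t1) at 1; rewrite eqA_mulZr; apply tscal_0. Qed.

Lemma tstar_0 : eqA (tstar t0) t0.
Proof. rewrite <- (tscal_0 t1) at 1; rewrite eqA_starZ, Cconj_0; apply tscal_0. Qed.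

Lemma tadd_0_l a : eqA (tadd t0 a) a.
Proof. rewrite eqA_addC; apply eqA_add0. Qed.

Lemma tadd_swap a b c d :
  eqA (tadd (tadd a b) (tadd c d)) (tadd (tadd a c) (tadd b d)).
Proof.
  rewrite <- !eqA_addA, (eqA_addA b c d), (eqA_addC b c), <- eqA_addA; reflexivity.
Qed.

Fixpoint tsum (f : nat -> term) (n : nat) : term :=
  match n with O => t0 | S k => tadd (tsum f k) (f k) end.

Lemma tsum_ext f g n : (forall i, (i < n)%nat -> eqA (f i) (g i)) -> eqA (tsum f n) (tsum g n).
Proof.
  induction n; simpl; intro H; [reflexivity|].
  rewrite IHn, H by (intros; auto with arith); reflexivity.
Qed.

Lemma tsum_0 f n : (forall i, (i < n)%nat -> eqA (f i) t0) -> eqA (tsum f n) t0.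
Proof.
  induction n; simpl; intro H; [reflexivity|].
  rewrite IHn, H by (intros; auto with arith); apply eqA_add0.
Qed.

Lemma tsum_add f g n : eqA (tsum (fun i => tadd (f i) (g i)) n) (tadd (tsum f n) (tsum g n)).
Proof.
  induction n; simpl; [symmetry; apply eqA_add0|].
  rewrite IHn; apply tadd_swap.
Qed.

Lemma tsum_scal c f n : eqA (tsum (fun i => tscal c (f i)) n) (tscal c (tsum f n)).
Proof.
  induction n; simpl; [symmetry; apply tscal_t0|].
  rewrite IHn, eqA_scalDr; reflexivity.
Qed.

Lemma tsum_single f n j :
  (j < n)%nat -> (forall i, (i < n)%nat -> i <> j -> eqA (f i) t0) -> eqA (tsum f n) (f j).
Proof.
  induction n; simpl; intros Hj H; [lia|].
  destruct (Nat.eq_dec j n) as [->|Hne].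
  - rewrite tsum_0 by (intros; apply H; lia); apply tadd_0_l.
  - rewrite IHn, (H n) by (intros; try apply H; lia); apply eqA_add0.
Qed.

(** * Spanning by the monomials [s^i s^{*j}] *)

Fixpoint spow n : term := match n with O => t1 | S k => tmul tS (spow k) end.

Lemma spow_comm n : eqA (tmul (spow n) tS) (tmul tS (spow n)).
Proof.
  induction n; simpl; [rewrite eqA_mul1l, eqA_mul1r; reflexivity|].
  rewrite <- eqA_mulA, IHn; reflexivity.
Qed.

Definition mono i j : term := tmul (spow i) (tstar (spow j)).

(** Since [monospan_all] puts every term here, induction on this predicate replaces induction on the
    syntax: linear facts need checking only on monomials and for invariance under [eqA]. *)
Inductive monospan : term -> Prop :=
| monospan_0 : monospan t0
| monospan_mono i j : monospan (mono i j)
| monospan_add a b : monospan a -> monospan b -> monospan (tadd a b)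
| monospan_scal c a : monospan a -> monospan (tscal c a)
| monospan_eqA a b : eqA a b -> monospan a -> monospan b.

Lemma monospan_lmul_ind t :
  (forall i j, monospan (tmul t (mono i j))) ->
  forall a, monospan a -> monospan (tmul t a).
Proof.
  intros H a Ha; induction Ha.
  - eapply monospan_eqA; [symmetry; apply tmul_0_r|apply monospan_0].
  - apply H.
  - eapply monospan_eqA; [symmetry; apply eqA_mulDr|apply monospan_add; assumption].
  - eapply monospan_eqA; [symmetry; apply eqA_mulZr|apply monospan_scal; assumption].
  - eapply monospan_eqA; [apply eqA_mul; [reflexivity|eassumption]|assumption].
Qed.

Lemma tS_mono i j : eqA (tmul tS (mono i j)) (mono (S i) j).
Proof. apply eqA_mulA. Qed.

Lemma tS_star_mono_S i j : eqA (tmul (tstar tS) (mono (S i) j)) (mono i j).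
Proof.
  unfold mono; simpl.
  rewrite <- eqA_mulA, (eqA_mulA (tstar tS) tS), eqA_rel; apply eqA_mul1l.
Qed.

Lemma tS_star_mono_0 j : eqA (tmul (tstar tS) (mono 0 j)) (mono 0 (S j)).
Proof.
  unfold mono; simpl; rewrite !eqA_mul1l, <- spow_comm; symmetry; apply eqA_starM.
Qed.

(** The relation [s^* s = 1] reduces [s^*] times a monomial to a monomial. The claim for [tstar t]
    is carried along because stars may sit anywhere in a term: the star case merely exchanges the
    two halves. *)
Lemma monospan_lmul t :
  (forall a, monospan a -> monospan (tmul t a)) /\
  (forall a, monospan a -> monospan (tmul (tstar t) a)).
Proof.
  induction t as [| | |a [IHa IHa'] b [IHb IHb']|c a [IHa IHa']|a [IHa IHa'] b [IHb IHb']|a [IHa IHa']].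
  - split; apply monospan_lmul_ind; intros i j.
    + eapply monospan_eqA; [symmetry; apply tS_mono|apply monospan_mono].
    + destruct i.
      * eapply monospan_eqA; [symmetry; apply tS_star_mono_0|apply monospan_mono].
      * eapply monospan_eqA; [symmetry; apply tS_star_mono_S|apply monospan_mono].
  - split; intros a Ha; eapply monospan_eqA; try exact Ha.
    + symmetry; apply eqA_mul1l.
    + rewrite eqA_star1, eqA_mul1l; reflexivity.
  - split; intros a Ha; eapply monospan_eqA; try exact monospan_0.
    + symmetry; apply tmul_0_l.
    + rewrite tstar_0, tmul_0_l; reflexivity.
  - split; intros d Hd; eapply monospan_eqA.
    + symmetry; apply eqA_mulDl.
    + apply monospan_add; auto.
    + rewrite eqA_starD, eqA_mulDl; reflexivity.
    + apply monospan_add; auto.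
  - split; intros d Hd; eapply monospan_eqA.
    + symmetry; apply eqA_mulZl.
    + apply monospan_scal; auto.
    + rewrite eqA_starZ, eqA_mulZl; reflexivity.
    + apply monospan_scal; auto.
  - split; intros d Hd; eapply monospan_eqA.
    + apply eqA_mulA.
    + auto.
    + rewrite eqA_starM, <- eqA_mulA; reflexivity.
    + auto.
  - split; [assumption|]; intros d Hd; eapply monospan_eqA.
    + rewrite eqA_starK; reflexivity.
    + auto.
Qed.

Lemma monospan_all t : monospan t.
Proof.
  apply monospan_eqA with (tmul t (mono 0 0)).
  - unfold mono; simpl; rewrite eqA_star1, !eqA_mul1r; reflexivity.
  - apply monospan_lmul, monospan_mono.
Qed.

(** * The shift representation and its matrices *)

Definition pi0a (t : term) : cseq -> cseq := snd (pi0p t).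

Definition linear_map (T : cseq -> cseq) : Prop :=
  (forall u v, T (fun n => (u n + v n)%K) = fun n => (T u n + T v n)%K) /\
  (forall c u, T (fun n => (c * u n)%K) = fun n => (c * T u n)%K).

Lemma pi0p_eta t : pi0p t = (pi0 t, pi0a t).
Proof. unfold pi0, pi0a; destruct (pi0p t); reflexivity. Qed.

Lemma pi0_tadd a b : pi0 (tadd a b) = fun phi n => (pi0 a phi n + pi0 b phi n)%K.
Proof. unfold pi0 at 1; simpl; rewrite !pi0p_eta; reflexivity. Qed.
Lemma pi0a_tadd a b : pi0a (tadd a b) = fun phi n => (pi0a a phi n + pi0a b phi n)%K.
Proof. unfold pi0a at 1; simpl; rewrite !pi0p_eta; reflexivity. Qed.
Lemma pi0_tscal c a : pi0 (tscal c a) = fun phi n => (c * pi0 a phi n)%K.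
Proof. unfold pi0 at 1; simpl; rewrite !pi0p_eta; reflexivity. Qed.
Lemma pi0a_tscal c a : pi0a (tscal c a) = fun phi n => (Cconj c * pi0a a phi n)%K.
Proof. unfold pi0a at 1; simpl; rewrite !pi0p_eta; reflexivity. Qed.
Lemma pi0_tmul a b : pi0 (tmul a b) = fun phi => pi0 a (pi0 b phi).
Proof. unfold pi0 at 1; simpl; rewrite !pi0p_eta; reflexivity. Qed.
Lemma pi0a_tmul a b : pi0a (tmul a b) = fun phi => pi0a b (pi0a a phi).
Proof. unfold pi0a at 1; simpl; rewrite !pi0p_eta; reflexivity. Qed.
Lemma pi0_tstar a : pi0 (tstar a) = pi0a a.
Proof. unfold pi0 at 1; simpl; rewrite !pi0p_eta; reflexivity. Qed.
Lemma pi0a_tstar a : pi0a (tstar a) = pi0 a.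
Proof. unfold pi0a at 1; simpl; rewrite !pi0p_eta; reflexivity. Qed.

Lemma pi0_linear t : linear_map (pi0 t) /\ linear_map (pi0a t).
Proof.
  induction t as [| | |a [[A1 A2] [A3 A4]] b [[B1 B2] [B3 B4]]|c a [[A1 A2] [A3 A4]]
    |a [[A1 A2] [A3 A4]] b [[B1 B2] [B3 B4]]|a [A A']].
  - split; split; intros; extensionality n; try reflexivity.
    + destruct n; unfold pi0; simpl; [ring|reflexivity].
    + destruct n; unfold pi0; simpl; [ring|reflexivity].
  - split; split; reflexivity.
  - split; split; intros; extensionality n; unfold pi0, pi0a; simpl; ring.
  - rewrite pi0_tadd, pi0a_tadd; split; split; intros; extensionality n;
      rewrite ?A1, ?A2, ?A3, ?A4, ?B1, ?B2, ?B3, ?B4; ring.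
  - rewrite pi0_tscal, pi0a_tscal; split; split; intros; extensionality n;
      rewrite ?A1, ?A2, ?A3, ?A4; ring.
  - rewrite pi0_tmul, pi0a_tmul; split; split; intros.
    + rewrite B1, A1; reflexivity.
    + rewrite B2, A2; reflexivity.
    + rewrite A3, B3; reflexivity.
    + rewrite A4, B4; reflexivity.
  - rewrite pi0_tstar, pi0a_tstar; split; assumption.
Qed.

Lemma pi0_sound a b : eqA a b -> pi0 a = pi0 b /\ pi0a a = pi0a b.
Proof.
  induction 1;
    repeat match goal with H : _ /\ _ |- _ => destruct H end;
    repeat rewrite ?pi0_tadd, ?pi0a_tadd, ?pi0_tscal, ?pi0a_tscal, ?pi0_tmul,
      ?pi0a_tmul, ?pi0_tstar, ?pi0a_tstar;
    try (split; congruence);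
    try (repeat match goal with E : _ = _ |- _ => rewrite E; clear E end;
         split; reflexivity);
    try (split; extensionality phi; extensionality n; unfold pi0, pi0a; simpl; C_solve; fail).
  (* The remaining four cases are the distributive and scalar laws of the product. They need
     linearity of the outer map, which is the left factor for [pi0] and, the order being reversed,
     the right one for [pi0a]. *)
  - split; extensionality phi; [reflexivity|].
    rewrite (proj1 (proj2 (pi0_linear c))); reflexivity.
  - split; extensionality phi; [|reflexivity].
    rewrite (proj1 (proj1 (pi0_linear a))); reflexivity.
  - split; extensionality phi; [reflexivity|].
    rewrite (proj2 (proj2 (pi0_linear b))); reflexivity.
  - split; extensionality phi; [|reflexivity].
    rewrite (proj2 (proj1 (pi0_linear a))); reflexivity.
Qed.

Definition mat t : nat -> nat -> C := fun i j => pi0 t (e_basis j) i.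

Lemma mat_eqA a b : eqA a b -> mat a = mat b.
Proof. intro H; unfold mat; rewrite (proj1 (pi0_sound a b H)); reflexivity. Qed.

Lemma mat_t0 i j : mat t0 i j = C0.
Proof. reflexivity. Qed.

Lemma mat_tadd a b i j : mat (tadd a b) i j = (mat a i j + mat b i j)%K.
Proof. unfold mat; rewrite pi0_tadd; reflexivity. Qed.

Lemma mat_tscal c a i j : mat (tscal c a) i j = (c * mat a i j)%K.
Proof. unfold mat; rewrite pi0_tscal; reflexivity. Qed.

Lemma pi0_spow p phi i : pi0 (spow p) phi i = if (i <? p)%nat then C0 else phi (i - p)%nat.
Proof.
  revert i; induction p; intro i; simpl.
  - rewrite Nat.sub_0_r; reflexivity.
  - rewrite pi0_tmul; destruct i; [reflexivity|].
    unfold pi0 at 1; simpl; apply IHp.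
Qed.

Lemma pi0a_spow q phi i : pi0a (spow q) phi i = phi (i + q)%nat.
Proof.
  revert phi i; induction q; intros phi i; simpl.
  - rewrite Nat.add_0_r; reflexivity.
  - rewrite pi0a_tmul, IHq, Nat.add_succ_r; reflexivity.
Qed.

Lemma pi0_mono p q phi i :
  pi0 (mono p q) phi i = if (i <? p)%nat then C0 else phi (i - p + q)%nat.
Proof.
  unfold mono; rewrite pi0_tmul, pi0_spow, pi0_tstar.
  destruct (i <? p)%nat; [reflexivity|apply pi0a_spow].
Qed.

Lemma mono_star p q : eqA (tstar (mono p q)) (mono q p).
Proof. unfold mono; rewrite eqA_starM, eqA_starK; reflexivity. Qed.

Lemma mat_mono p q i j :
  mat (mono p q) i j = if andb (p <=? i)%nat (i + q =? p + j)%nat then C1 else C0.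
Proof.
  unfold mat; rewrite pi0_mono; unfold e_basis.
  destruct (Nat.ltb_spec i p), (Nat.leb_spec p i); try lia; simpl; [reflexivity|].
  destruct (Nat.eqb_spec (i - p + q) j), (Nat.eqb_spec (i + q) (p + j)); try lia; reflexivity.
Qed.

(** Both sides are conjugate-linear in [t], and on monomials the star exchanges the two
    exponents. *)
Lemma mat_tstar t i j : mat (tstar t) i j = Cconj (mat t j i).
Proof.
  revert i j; induction (monospan_all t) as [|p q|a b _ IHa _ IHb|c a _ IHa|a b E _ IHa]; intros i j.
  - rewrite (mat_eqA _ _ tstar_0), !mat_t0, Cconj_0; reflexivity.
  - rewrite (mat_eqA _ _ (mono_star p q)), !mat_mono.
    destruct (Nat.leb_spec q i), (Nat.leb_spec p j), (Nat.eqb_spec (i + p) (q + j)),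
      (Nat.eqb_spec (j + q) (p + i)); try lia; simpl; rewrite ?Cconj_0, ?Cconj_1; reflexivity.
  - rewrite (mat_eqA _ _ (eqA_starD a b)), !mat_tadd, Cconj_add, IHa, IHb; reflexivity.
  - rewrite (mat_eqA _ _ (eqA_starZ c a)), !mat_tscal, Cconj_mul, IHa; reflexivity.
  - rewrite <- (mat_eqA _ _ (eqA_star _ _ E)), <- (mat_eqA _ _ E); apply IHa.
Qed.

(** Row [i] of the matrix is supported below [i + N], with [N] uniform in [i]; hence the operator
    acts by finite sums on arbitrary sequences. *)
Lemma pi0_local t :
  exists N, forall phi i L, (i + N <= L)%nat ->
    pi0 t phi i = Csum (fun k => (mat t i k * phi k)%K) L.
Proof.
  induction (monospan_all t) as [|p q|a b _ [N IHa] _ [N' IHb]|c a _ [N IHa]|a b E _ [N IHa]].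
  - exists O; intros; rewrite Csum_0; [reflexivity|intros; rewrite mat_t0; ring].
  - exists (S q); intros phi i L HL; rewrite pi0_mono.
    destruct (Nat.ltb_spec i p).
    + rewrite Csum_0; [reflexivity|]; intros; rewrite mat_mono.
      destruct (Nat.leb_spec p i); [lia|simpl; ring].
    + rewrite (Csum_single _ L (i - p + q)%nat); [|lia|].
      * rewrite mat_mono, (proj2 (Nat.leb_le p i)), (proj2 (Nat.eqb_eq _ _)) by lia; simpl; ring.
      * intros; rewrite mat_mono, (proj2 (Nat.eqb_neq _ _)), Bool.andb_false_r by lia; ring.
  - exists (N + N')%nat; intros phi i L HL; rewrite pi0_tadd, (IHa _ _ L), (IHb _ _ L) by lia.
    rewrite <- Csum_add; apply Csum_ext; intros; rewrite mat_tadd; ring.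
  - exists N; intros phi i L HL; rewrite pi0_tscal, (IHa _ _ L) by lia.
    rewrite <- Csum_mul_l; apply Csum_ext; intros; rewrite mat_tscal; ring.
  - exists N; intros phi i L HL; rewrite <- (proj1 (pi0_sound _ _ E)), <- (mat_eqA _ _ E).
    apply IHa; assumption.
Qed.

(** This is [A - S A S^*]. It turns the matrix of [s^p s^{*q}] into the matrix unit at [(p, q)], and
    so reads off the coefficients of the expansion in monomials. Finite support of the result means
    banded and Toeplitz up to a finite corner. *)
Definition diag_diff (A : nat -> nat -> C) i j : C :=
  match i, j with S i', S j' => (A i j - A i' j')%K | _, _ => A i j end.

(** Each diagonal is recovered by summing its differences from the border inward. *)
Lemma diag_diff_inj A B :
  (forall i j, diag_diff A i j = diag_diff B i j) -> forall i j, A i j = B i j.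
Proof.
  intros H; induction i; intro j; [apply (H O j)|destruct j; [apply (H (S i) O)|]].
  pose proof (H (S i) (S j)) as E; simpl in E; rewrite IHi in E.
  transitivity (A (S i) (S j) - B i j + B i j)%K; [ring|rewrite E; ring].
Qed.

Lemma diag_diff_tadd a b i j :
  diag_diff (mat (tadd a b)) i j = (diag_diff (mat a) i j + diag_diff (mat b) i j)%K.
Proof. destruct i, j; cbn [diag_diff]; rewrite !mat_tadd; ring. Qed.

Lemma diag_diff_tscal c a i j :
  diag_diff (mat (tscal c a)) i j = (c * diag_diff (mat a) i j)%K.
Proof. destruct i, j; cbn [diag_diff]; rewrite !mat_tscal; ring. Qed.

Lemma diag_diff_t0 i j : diag_diff (mat t0) i j = C0.
Proof. destruct i, j; cbn [diag_diff]; rewrite !mat_t0; ring. Qed.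

Lemma diag_diff_mono p q i j :
  diag_diff (mat (mono p q)) i j = if andb (i =? p)%nat (j =? q)%nat then C1 else C0.
Proof.
  destruct i, j; cbn [diag_diff]; rewrite !mat_mono;
  repeat match goal with
  | |- context [Nat.leb ?a ?b] => destruct (Nat.leb_spec a b)
  | |- context [Nat.eqb ?a ?b] => destruct (Nat.eqb_spec a b)
  end; cbn [andb]; try (exfalso; lia); ring.
Qed.

(** * Normal forms, faithfulness and realizable matrices *)

Definition comb K (b : nat -> nat -> C) : term :=
  tsum (fun i => tsum (fun j => tscal (b i j) (mono i j)) K) K.

Lemma comb_ext K b b' : (forall i j, b i j = b' i j) -> eqA (comb K b) (comb K b').
Proof. intro H; apply tsum_ext; intros; apply tsum_ext; intros; rewrite H; reflexivity. Qed.

(** Allowing every [K] above a threshold lets two terms be expanded over a common range, as needed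
    for sums and for [pi0_faithful]. *)
Lemma normal_form t :
  exists N, forall K, (N <= K)%nat -> eqA t (comb K (diag_diff (mat t))).
Proof.
  induction (monospan_all t) as [|p q|a b _ [N IHa] _ [N' IHb]|c a _ [N IHa]|a b E _ [N IHa]].
  - exists O; intros K _; symmetry; apply tsum_0; intros; apply tsum_0; intros.
    rewrite diag_diff_t0; apply tscal_0.
  - exists (S (p + q)); intros K HK; symmetry; unfold comb.
    rewrite (tsum_single _ K p); [|lia|].
    + rewrite (tsum_single _ K q); [|lia|].
      * rewrite diag_diff_mono, !Nat.eqb_refl; apply eqA_scal1.
      * intros; rewrite diag_diff_mono, (proj2 (Nat.eqb_neq i q)), Bool.andb_false_r by assumption.
        apply tscal_0.
    + intros; apply tsum_0; intros.
      rewrite diag_diff_mono, (proj2 (Nat.eqb_neq i p)) by assumption; apply tscal_0.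
  - exists (N + N')%nat; intros K HK.
    rewrite (IHa K), (IHb K) at 1 by lia; unfold comb; rewrite <- tsum_add.
    apply tsum_ext; intros; rewrite <- tsum_add; apply tsum_ext; intros.
    rewrite diag_diff_tadd, eqA_scalDl; reflexivity.
  - exists N; intros K HK.
    rewrite (IHa K) at 1 by lia; unfold comb; rewrite <- tsum_scal.
    apply tsum_ext; intros; rewrite <- tsum_scal; apply tsum_ext; intros.
    rewrite diag_diff_tscal, eqA_scalA; reflexivity.
  - exists N; intros K HK; rewrite <- (mat_eqA _ _ E), <- E; auto.
Qed.

(** The coefficients of the normal form depend on the matrix alone. *)
Lemma pi0_faithful a b : (forall i j, mat a i j = mat b i j) -> eqA a b.
Proof.
  intro H; destruct (normal_form a) as [N HN]; destruct (normal_form b) as [N' HN'].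
  rewrite (HN (N + N')%nat), (HN' (N + N')%nat) by lia; apply comb_ext.
  intros i j; destruct i, j; simpl; rewrite !H; reflexivity.
Qed.

Lemma diag_diff_tsum f n i j :
  diag_diff (mat (tsum f n)) i j = Csum (fun k => diag_diff (mat (f k)) i j) n.
Proof.
  induction n; simpl; [apply diag_diff_t0|rewrite diag_diff_tadd, IHn; reflexivity].
Qed.

Lemma diag_diff_comb K b i j :
  diag_diff (mat (comb K b)) i j =
  if andb (i <? K)%nat (j <? K)%nat then b i j else C0.
Proof.
  assert (T : forall p q, diag_diff (mat (tscal (b p q) (mono p q))) i j =
              if andb (i =? p)%nat (j =? q)%nat then b p q else C0).
  { intros p q; rewrite diag_diff_tscal, diag_diff_mono.
    destruct (andb _ _); ring. }
  unfold comb; rewrite diag_diff_tsum.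
  destruct (Nat.ltb_spec i K); simpl.
  - rewrite (Csum_single _ K i); [|assumption|].
    + rewrite diag_diff_tsum; destruct (Nat.ltb_spec j K).
      * rewrite (Csum_single _ K j); [|assumption|].
        -- rewrite T, !Nat.eqb_refl; reflexivity.
        -- intros; rewrite T, (proj2 (Nat.eqb_neq j _)), Bool.andb_false_r by auto; reflexivity.
      * apply Csum_0; intros.
        rewrite T, (proj2 (Nat.eqb_neq j _)), Bool.andb_false_r by lia; reflexivity.
    + intros; rewrite diag_diff_tsum; apply Csum_0; intros.
      rewrite T, (proj2 (Nat.eqb_neq i _)) by auto; reflexivity.
  - apply Csum_0; intros; rewrite diag_diff_tsum; apply Csum_0; intros.
    rewrite T, (proj2 (Nat.eqb_neq i _)) by lia; reflexivity.
Qed.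

Lemma mat_realize K Y :
  (forall i j, (K <= i \/ K <= j)%nat -> diag_diff Y i j = C0) ->
  forall i j, mat (comb K (diag_diff Y)) i j = Y i j.
Proof.
  intro H; apply diag_diff_inj; intros i j; rewrite diag_diff_comb.
  destruct (Nat.ltb_spec i K), (Nat.ltb_spec j K); simpl;
    try reflexivity; symmetry; apply H; lia.
Qed.

Lemma diag_diff_bounded t :
  exists K, forall i j, (K <= i \/ K <= j)%nat -> diag_diff (mat t) i j = C0.
Proof.
  destruct (normal_form t) as [K HK]; exists K; intros i j H.
  rewrite (mat_eqA _ _ (HK K (Nat.le_refl K))), diag_diff_comb.
  destruct (Nat.ltb_spec i K), (Nat.ltb_spec j K); simpl; try reflexivity; lia.
Qed.

(** Walking back along a diagonal that starts outside the corner meets only zero differences, down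
    to a zero border entry. *)
Lemma band_of_diag_diff A K :
  (forall i j, (K <= i \/ K <= j)%nat -> diag_diff A i j = C0) ->
  forall i j, (i + K <= j \/ j + K <= i)%nat -> A i j = C0.
Proof.
  intro H; induction i; intros j Hj.
  - apply (H O j); lia.
  - destruct j; [apply (H (S i) O); lia|].
    assert (E : diag_diff A (S i) (S j) = C0) by (apply H; lia); simpl in E.
    rewrite IHi in E by lia.
    transitivity (A (S i) (S j) - C0)%K; [ring|exact E].
Qed.

Lemma toep_of_diag_diff A K :
  (forall i j, (K <= i \/ K <= j)%nat -> diag_diff A i j = C0) ->
  forall i j, (K <= i)%nat -> (K <= j)%nat -> A (S i) (S j) = A i j.
Proof.
  intros H i j Hi Hj.
  assert (E : diag_diff A (S i) (S j) = C0) by (apply H; lia); simpl in E.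
  transitivity (A (S i) (S j) - A i j + A i j)%K; [ring|rewrite E; ring].
Qed.

(** * Factorization inside the algebra *)

Lemma mat_tmul a b :
  exists N, forall i j L, (i + N <= L)%nat ->
    mat (tmul a b) i j = Csum (fun k => (mat a i k * mat b k j)%K) L.
Proof.
  destruct (pi0_local a) as [N HN]; exists N; intros i j L HL.
  unfold mat at 1; rewrite pi0_tmul; apply HN; assumption.
Qed.

Lemma psd_factorization x :
  eqA x (tstar x) -> (forall m, psd m (mat x)) ->
  exists y, eqA x (tmul (tstar y) y) /\ lower_triangular (pi0 y).
Proof.
  intros Hx P.
  assert (H : herm (mat x)) by (intros i j; rewrite <- mat_tstar, <- (mat_eqA _ _ Hx); reflexivity).
  destruct (diag_diff_bounded x) as [K HK].
  pose proof (band_of_diag_diff _ K HK) as Band.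
  pose proof (toep_of_diag_diff _ K HK) as Toep.
  set (Y := factor (mat x)).
  (* Away from the border, decrease both indices by one, so that one of them is still at least [2K].
     If the other is at least [K], the Toeplitz property applies; otherwise they differ by more than
     [K], and both entries of the difference vanish by triangularity or the band. *)
  assert (HY : forall i j, (S (K + K) <= i \/ S (K + K) <= j)%nat -> diag_diff Y i j = C0).
  { intros i j Hij.
    assert (Z : forall i j, (i < j \/ j + K <= i)%nat -> Y i j = C0).
    { intros i' j' [Hl|Hl]; [apply factor_upper; assumption|].
      apply factor_band with K; assumption. }
    destruct i; [apply Z; lia|destruct j; [apply Z; lia|]]; simpl.
    destruct (Nat.le_gt_cases K i), (Nat.le_gt_cases K j); try (rewrite !Z by lia; ring).
    unfold Y; rewrite (factor_toep _ K) by assumption; ring. }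
  exists (comb (S (K + K)) (diag_diff Y)); set (y := comb _ _).
  assert (My : forall i j, mat y i j = Y i j) by (apply mat_realize; assumption).
  split.
  - apply pi0_faithful; intros i j.
    destruct (mat_tmul (tstar y) y) as [N HN].
    (* This length suffices both for the product formula and for [factor_gram]. *)
    rewrite (HN i j (S (i + j + K + N))) by lia.
    symmetry; erewrite Csum_ext; [apply factor_gram with K; try assumption; lia|].
    intros; cbv beta; rewrite mat_tstar, !My; reflexivity.
  - intros i j Hij; fold (mat y i j); rewrite My; apply factor_upper; assumption.
Qed.

(** * The Hilbert space of square-summable sequences *)

Lemma is_Clim_unique z l : is_Clim z l -> Clim z = l.
Proof.
  intros [H1 H2]; apply C_ext; simpl.
  - rewrite (is_lim_seq_unique _ _ H1); reflexivity.
  - rewrite (is_lim_seq_unique _ _ H2); reflexivity.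
Qed.

Lemma is_Clim_ext y z l : (forall n, y n = z n) -> is_Clim y l -> is_Clim z l.
Proof.
  intros E [H1 H2]; split; [eapply is_lim_seq_ext, H1|eapply is_lim_seq_ext, H2];
    intro; simpl; rewrite E; reflexivity.
Qed.

Lemma is_Clim_conj z l : is_Clim z l -> is_Clim (fun n => Cconj (z n)) (Cconj l).
Proof.
  intros [H1 H2]; split; simpl; [exact H1|].
  apply is_lim_seq_opp in H2; exact H2.
Qed.

Lemma is_Clim_incr_1 z l : is_Clim (fun n => z (S n)) l <-> is_Clim z l.
Proof.
  unfold is_Clim; rewrite <- (is_lim_seq_incr_1 (fun k => Cre (z k))),
    <- (is_lim_seq_incr_1 (fun k => Cim (z k))); reflexivity.
Qed.

Definition psum (u v : cseq) (n : nat) : C := Csum (fun k => (u k * Cconj (v k))%K) n.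
Definition nsq (u : cseq) (n : nat) : R := Cre (psum u u n).
Definition ip (u v : cseq) : C := Clim (psum u v).
(** Bounded partial sums, equivalent to [in_l2] by monotonicity, give closure under the vector
    operations without handling limits. *)
Definition summable (u : cseq) : Prop := exists B, forall n, nsq u n <= B.

Definition vadd (u v : cseq) : cseq := fun n => (u n + v n)%K.
Definition vscal c (u : cseq) : cseq := fun n => (c * u n)%K.

Lemma psum_add_l u v w n : psum (vadd u v) w n = (psum u w n + psum v w n)%K.
Proof. unfold psum, vadd; rewrite <- Csum_add; apply Csum_ext; intros; ring. Qed.

Lemma psum_scal_l c u w n : psum (vscal c u) w n = (c * psum u w n)%K.
Proof. unfold psum, vscal; rewrite <- Csum_mul_l; apply Csum_ext; intros; ring. Qed.

Lemma psum_conj u v n : psum v u n = Cconj (psum u v n).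
Proof.
  unfold psum; rewrite Csum_conj; apply Csum_ext; intros.
  rewrite Cconj_mul, Cconj_invol; ring.
Qed.

Lemma nsq_0 u : nsq u 0 = 0.
Proof. reflexivity. Qed.

Lemma nsq_S u n : nsq u (S n) = nsq u n + Cnorm2 (u n).
Proof. unfold nsq, psum, Cnorm2; simpl; ring. Qed.

Lemma nsq_incr u n : nsq u n <= nsq u (S n).
Proof. rewrite nsq_S; pose proof (Cnorm2_pos (u n)); lra. Qed.

Lemma nsq_mono u m n : (m <= n)%nat -> nsq u m <= nsq u n.
Proof. induction 1 as [|n _ IH]; [lra|pose proof (nsq_incr u n); lra]. Qed.

Lemma nsq_zero n : nsq (fun _ => C0) n = 0.
Proof. induction n; [apply nsq_0|rewrite nsq_S, IHn; unfold Cnorm2; simpl; ring]. Qed.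

Lemma nsq_pos u n : 0 <= nsq u n.
Proof. rewrite <- (nsq_0 u); apply nsq_mono; lia. Qed.

Lemma Cnorm2_le_nsq u n : Cnorm2 (u n) <= nsq u (S n).
Proof. rewrite nsq_S; pose proof (nsq_pos u n); lra. Qed.

Lemma nsq_add u v n : nsq (vadd u v) n <= 2 * nsq u n + 2 * nsq v n.
Proof.
  induction n; [rewrite !nsq_0; lra|rewrite !nsq_S].
  assert (Cnorm2 (vadd u v n) <= 2 * Cnorm2 (u n) + 2 * Cnorm2 (v n)); [|lra].
  unfold Cnorm2, vadd; simpl.
  pose proof (Rle_0_sqr (Cre (u n) - Cre (v n))).
  pose proof (Rle_0_sqr (Cim (u n) - Cim (v n))); unfold Rsqr in *; lra.
Qed.

Lemma nsq_scal c u n : nsq (vscal c u) n = Cnorm2 c * nsq u n.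
Proof.
  induction n; [rewrite !nsq_0; ring|rewrite !nsq_S, IHn].
  unfold Cnorm2, vscal; simpl; ring.
Qed.

Lemma summable_add u v : summable u -> summable v -> summable (vadd u v).
Proof.
  intros [B HB] [B' HB']; exists (2 * B + 2 * B'); intro n.
  pose proof (nsq_add u v n); pose proof (HB n); pose proof (HB' n); lra.
Qed.

Lemma summable_scal c u : summable u -> summable (vscal c u).
Proof.
  intros [B HB]; exists (Cnorm2 c * B); intro n; rewrite nsq_scal.
  apply Rmult_le_compat_l; [apply Cnorm2_pos|apply HB].
Qed.

(** An additive [f] covers [Cre] and [Cim] at once. The index shift arises because [sum_f_R0 a n]
    includes the term [n] while [Csum z n] stops before it. *)
Lemma sum_f_R0_Csum (f : C -> R) (a : nat -> R) (z : nat -> C) n :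
  f C0 = 0 -> (forall x y, f (x + y)%K = f x + f y) -> (forall k, a k = f (z k)) ->
  sum_f_R0 a n = f (Csum z (S n)).
Proof.
  intros H0 Hp E; induction n; simpl in *.
  - rewrite Hp, H0, E; ring.
  - rewrite IHn, !Hp, E; reflexivity.
Qed.

Lemma infinite_sum_Csum (f : C -> R) (a : nat -> R) (z : nat -> C) (l : R) :
  f C0 = 0 -> (forall x y, f (x + y)%K = f x + f y) -> (forall k, a k = f (z k)) ->
  infinite_sum a l <-> is_lim_seq (fun n => f (Csum z n)) l.
Proof.
  intros H0 Hp E.
  rewrite (is_lim_seq_incr_1 (fun n => f (Csum z n))).
  transitivity (is_lim_seq (sum_f_R0 a) l); [symmetry; apply is_lim_seq_Reals|].
  split; apply is_lim_seq_ext; intro n; [|symmetry]; apply sum_f_R0_Csum; assumption.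
Qed.

Lemma infinite_sum_Cre z l :
  infinite_sum (fun n => Cre (z n)) l <-> is_lim_seq (fun n => Cre (Csum z n)) l.
Proof. apply infinite_sum_Csum; reflexivity. Qed.

Lemma infinite_sum_Cim z l :
  infinite_sum (fun n => Cim (z n)) l <-> is_lim_seq (fun n => Cim (Csum z n)) l.
Proof. apply infinite_sum_Csum; reflexivity. Qed.

Lemma infinite_sum_Cnorm2 u l :
  infinite_sum (fun n => Cnorm2 (u n)) l <-> is_lim_seq (nsq u) l.
Proof.
  apply (infinite_sum_Csum Cre); try reflexivity.
  intro; unfold Cnorm2; simpl; ring.
Qed.

Lemma in_l2_summable u : in_l2 u <-> summable u.
Proof.
  unfold in_l2; split.
  - intros [l Hl]; exists l; intro n; apply infinite_sum_Cnorm2 in Hl.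
    apply (is_lim_seq_incr_compare _ _ Hl), nsq_incr.
  - intros [B HB].
    destruct (ex_finite_lim_seq_incr (nsq u) B (nsq_incr u) HB) as [l Hl].
    exists l; apply infinite_sum_Cnorm2; assumption.
Qed.

(** Polarization again: the real part is half of [nsq (u + v) - nsq u - nsq v], three bounded
    monotone sequences, so Cauchy-Schwarz is avoided. *)
Lemma psum_Cre_cvg u v :
  summable u -> summable v -> ex_finite_lim_seq (fun n => Cre (psum u v n)).
Proof.
  intros Hu Hv.
  assert (L : forall w, summable w -> ex_finite_lim_seq (nsq w)).
  { intros w [B HB]; apply ex_finite_lim_seq_incr with B; [apply nsq_incr|assumption]. }
  destruct (L u Hu) as [a Ha], (L v Hv) as [b Hb],
    (L _ (summable_add u v Hu Hv)) as [c Hc].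
  exists (/ 2 * (c - a - b)).
  eapply is_lim_seq_ext.
  2:{ apply is_lim_seq_mult'; [apply is_lim_seq_const|].
      apply is_lim_seq_minus'; [apply is_lim_seq_minus'|]; eassumption. }
  intro n; unfold nsq; rewrite psum_add_l.
  rewrite (psum_conj (vadd u v) u), (psum_conj (vadd u v) v), !psum_add_l.
  rewrite (psum_conj u v); simpl; field.
Qed.

Lemma ip_lim u v : summable u -> summable v -> is_Clim (psum u v) (ip u v).
Proof.
  intros Hu Hv; split; simpl; apply Lim_seq_correct'.
  - apply psum_Cre_cvg; assumption.
  - destruct (psum_Cre_cvg (vscal (- Ci) u) v) as [l Hl];
      [apply summable_scal; assumption|assumption|exists l].
    eapply is_lim_seq_ext, Hl; intro n; cbv beta; rewrite psum_scal_l; simpl; ring.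
Qed.

Lemma ip_add_l u v w :
  summable u -> summable v -> summable w -> ip (vadd u v) w = (ip u w + ip v w)%K.
Proof.
  intros; apply is_Clim_unique.
  eapply is_Clim_ext; [intro; symmetry; apply psum_add_l|].
  apply is_Clim_add; apply ip_lim; assumption.
Qed.

Lemma ip_scal_l c u w : summable u -> summable w -> ip (vscal c u) w = (c * ip u w)%K.
Proof.
  intros; apply is_Clim_unique.
  eapply is_Clim_ext; [intro; symmetry; apply psum_scal_l|].
  apply is_Clim_mul; [apply is_Clim_const|apply ip_lim; assumption].
Qed.

Lemma ip_conj u v : summable u -> summable v -> ip v u = Cconj (ip u v).
Proof.
  intros; apply is_Clim_unique.
  eapply is_Clim_ext; [intro; symmetry; apply psum_conj|].
  apply is_Clim_conj, ip_lim; assumption.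
Qed.

Lemma nsq_le_ip u n : summable u -> nsq u n <= Cre (ip u u).
Proof.
  intro H; apply (is_lim_seq_incr_compare (nsq u)); [apply (ip_lim u u H H)|apply nsq_incr].
Qed.

Lemma ip_le u B : summable u -> (forall n, nsq u n <= B) -> Cre (ip u u) <= B.
Proof.
  intros H HB; apply (is_lim_seq_le (nsq u) (fun _ => B) (Cre (ip u u)) B HB);
    [apply (ip_lim u u H H)|apply is_lim_seq_const].
Qed.

Lemma ip_pos u : summable u -> 0 <= Cre (ip u u).
Proof. intro H; apply (nsq_le_ip u 0 H). Qed.

Lemma ip_def u : summable u -> ip u u = C0 -> u = fun _ => C0.
Proof.
  intros H E; extensionality n; apply Cnorm2_eq0.
  pose proof (nsq_le_ip u (S n) H) as L; rewrite E in L; simpl in L.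
  pose proof (Cnorm2_le_nsq u n); pose proof (Cnorm2_pos (u n)); lra.
Qed.

Definition vsub (u v : cseq) : cseq := vadd u (fun n => (- v n)%K).

Lemma vopp_scal u : (fun n => (- u n)%K) = vscal (- C1)%K u.
Proof. extensionality n; unfold vscal; ring. Qed.

Lemma summable_opp u : summable u -> summable (fun n => (- u n)%K).
Proof. rewrite vopp_scal; apply summable_scal. Qed.

Lemma summable_sub u v : summable u -> summable v -> summable (vsub u v).
Proof. intros; apply summable_add; [|apply summable_opp]; assumption. Qed.

Lemma nsq_sub_lim (f : nat -> cseq) l u K :
  (forall i, is_Clim (fun n => f n i) (l i)) ->
  is_lim_seq (fun n => nsq (vsub u (f n)) K) (nsq (vsub u l) K).
Proof.
  intro H; unfold nsq, psum.
  apply (is_Clim_sum (fun n k => (vsub u (f n) k * Cconj (vsub u (f n) k))%K)); intros i _.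
  assert (is_Clim (fun n => vsub u (f n) i) (vsub u l i)).
  { unfold vsub, vadd; apply is_Clim_add; [apply is_Clim_const|].
    apply is_Clim_ext with (fun n => (- C1 * f n i)%K); [intro; ring|].
    replace (- l i)%K with (- C1 * l i)%K by ring.
    apply is_Clim_mul; [apply is_Clim_const|apply H]. }
  apply is_Clim_mul; [|apply is_Clim_conj]; assumption.
Qed.

(** The candidate is the coordinatewise limit. The Cauchy bound on each partial sum of length [K]
    survives the limit in [n] uniformly in [K], which gives both summability and convergence in
    norm. *)
Lemma summable_complete (f : nat -> cseq) :
  (forall n, summable (f n)) ->
  (forall eps, 0 < eps -> exists N, forall m n, (N <= m)%nat -> (N <= n)%nat ->
     sqrt (Cre (ip (vsub (f m) (f n)) (vsub (f m) (f n)))) < eps) ->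
  exists l, summable l /\
    forall eps, 0 < eps -> exists N, forall n, (N <= n)%nat ->
      sqrt (Cre (ip (vsub (f n) l) (vsub (f n) l))) < eps.
Proof.
  intros Hs Hc.
  assert (Hd : forall m n, summable (vsub (f m) (f n))) by (intros; apply summable_sub; auto).
  assert (Hcoord : forall eps, 0 < eps -> exists N, forall m n i, (N <= m)%nat -> (N <= n)%nat ->
            sqrt (Cnorm2 (vsub (f m) (f n) i)) < eps).
  { intros eps He; destruct (Hc eps He) as [N HN]; exists N; intros m n i Hm Hn.
    eapply Rle_lt_trans; [|apply (HN m n Hm Hn)].
    apply sqrt_le_1_alt; eapply Rle_trans; [apply Cnorm2_le_nsq|apply nsq_le_ip, Hd]. }
  assert (Habs : forall a b, Rabs a <= sqrt (a * a + b * b)).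
  { intros a b; rewrite <- sqrt_Rsqr_abs; apply sqrt_le_1_alt; unfold Rsqr.
    pose proof (Rle_0_sqr b); unfold Rsqr in *; lra. }
  set (l := fun i => Clim (fun n => f n i)).
  assert (Hl : forall i, is_Clim (fun n => f n i) (l i)).
  { intro i; split; apply Lim_seq_correct', ex_lim_seq_cauchy_corr; intros [eps He];
      destruct (Hcoord eps He) as [N HN]; exists N; intros n m Hn Hm; simpl;
      (eapply Rle_lt_trans; [|apply (HN n m i Hn Hm)]);
      unfold Cnorm2, vsub, vadd; simpl.
    - apply Habs.
    - rewrite Rplus_comm; apply Habs. }
  assert (Hb : forall eps, 0 < eps -> exists N, forall m K, (N <= m)%nat ->
            nsq (vsub (f m) l) K <= eps * eps).
  { intros eps He; destruct (Hc eps He) as [N HN]; exists N; intros m K Hm.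
    apply (is_lim_seq_le_loc (fun n => nsq (vsub (f m) (f n)) K) (fun _ => eps * eps)
             (nsq (vsub (f m) l) K) (eps * eps)).
    - exists N; intros n Hn; eapply Rle_trans; [apply nsq_le_ip, Hd|].
      rewrite <- (sqrt_sqrt (Cre (ip _ _))) by apply ip_pos, Hd.
      specialize (HN m n Hm Hn).
      apply Rmult_le_compat; try apply sqrt_pos; lra.
    - apply nsq_sub_lim; assumption.
    - apply is_lim_seq_const. }
  assert (Sl : summable l).
  { destruct (Hb 1 Rlt_0_1) as [N HN].
    (* Summability of [l] follows from that of [f N] and of the difference, which is already
       bounded. *)
    replace l with (vsub (f N) (vsub (f N) l)).
    - apply summable_sub; [auto|exists (1 * 1); intro; apply HN; lia].
    - extensionality n; unfold vsub, vadd; ring. }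
  exists l; split; [assumption|].
  (* Halving restores the strict inequality lost in the limit. *)
  intros eps He; destruct (Hb (eps / 2)) as [N HN]; [lra|exists N; intros n Hn].
  apply Rle_lt_trans with (eps / 2); [|lra].
  rewrite <- (sqrt_square (eps / 2)) by lra; apply sqrt_le_1_alt.
  apply ip_le; [apply summable_sub; auto|intro; apply HN; assumption].
Qed.

(** * Square-summable sequences as a Hilbert space, and bounded maps on it *)

Definition l2car : Type := {u : cseq | summable u}.
Definition l2mk (u : cseq) (H : summable u) : l2car := exist _ u H.

Lemma l2_ext (u v : l2car) : proj1_sig u = proj1_sig v -> u = v.
Proof.
  destruct u as [u Hu], v as [v Hv]; simpl; intros ->; f_equal; apply proof_irrelevance.
Qed.

Lemma summable_0 : summable (fun _ => C0).
Proof. exists 0; intro n; rewrite nsq_zero; lra. Qed.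

Definition l2space : HilbertSpace.
Proof.
  refine (Build_HilbertSpace l2car
    (l2mk _ summable_0)
    (fun u v => l2mk _ (summable_add _ _ (proj2_sig u) (proj2_sig v)))
    (fun u => l2mk _ (summable_opp _ (proj2_sig u)))
    (fun c u => l2mk _ (summable_scal c _ (proj2_sig u)))
    (fun u v => ip (proj1_sig u) (proj1_sig v)) _ _ _ _ _ _ _ _ _ _ _ _ _ _).
  - intros u v w; apply l2_ext; extensionality n; simpl; unfold vadd; ring.
  - intros u v; apply l2_ext; extensionality n; simpl; unfold vadd; ring.
  - intros u; apply l2_ext; extensionality n; simpl; unfold vadd; ring.
  - intros u; apply l2_ext; extensionality n; simpl; unfold vadd; ring.
  - intros u; apply l2_ext; extensionality n; simpl; unfold vscal; ring.
  - intros a b u; apply l2_ext; extensionality n; simpl; unfold vscal; ring.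
  - intros a u v; apply l2_ext; extensionality n; simpl; unfold vscal, vadd; ring.
  - intros a b u; apply l2_ext; extensionality n; simpl; unfold vscal, vadd; ring.
  - intros u v w; apply ip_add_l; apply proj2_sig.
  - intros c u w; apply ip_scal_l; apply proj2_sig.
  - intros u v; apply ip_conj; apply proj2_sig.
  - intros u; apply ip_pos, proj2_sig.
  - intros u E; apply l2_ext; simpl; apply ip_def; [apply proj2_sig|exact E].
  - intros f Hf.
    destruct (summable_complete (fun n => proj1_sig (f n)) (fun n => proj2_sig (f n)) Hf)
      as [l [Sl Hl]].
    exists (l2mk l Sl); exact Hl.
Defined.

(** Bounding the partial sums of [T u], rather than its norm, makes summability of [T u] a
    consequence instead of a precondition. [B] bounds the square of the operator norm. *)
Definition bounded_map (T : cseq -> cseq) : Prop :=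
  exists B, 0 <= B /\ forall u n, summable u -> nsq (T u) n <= B * Cre (ip u u).

Lemma bounded_map_summable T u : bounded_map T -> summable u -> summable (T u).
Proof. intros [B [_ HB]] Hu; exists (B * Cre (ip u u)); intro n; apply HB; assumption. Qed.

Definition adjoint_maps (T T' : cseq -> cseq) : Prop :=
  forall u v, summable u -> summable v -> ip (T' u) v = ip u (T v).

Lemma adjoint_maps_sym T T' :
  bounded_map T -> bounded_map T' -> adjoint_maps T T' -> adjoint_maps T' T.
Proof.
  intros B B' H u v Hu Hv.
  rewrite (ip_conj v (T u)), <- H, (ip_conj (T' v) u);
    auto using bounded_map_summable.
Qed.

Lemma bounded_shift : bounded_map shift.
Proof.
  exists 1; split; [lra|]; intros u n Hu; rewrite Rmult_1_l.
  assert (E : forall n, nsq (shift u) (S n) = nsq u n).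
  { intro k; induction k.
    - rewrite nsq_S, !nsq_0; unfold Cnorm2; simpl; ring.
    - rewrite nsq_S, IHk, nsq_S; reflexivity. }
  destruct n; [apply ip_pos; assumption|rewrite E; apply nsq_le_ip; assumption].
Qed.

Lemma bounded_shift_adj : bounded_map shift_adj.
Proof.
  exists 1; split; [lra|]; intros u n Hu; rewrite Rmult_1_l.
  apply Rle_trans with (nsq u (S n)); [|apply nsq_le_ip; assumption].
  induction n.
  - rewrite nsq_0; apply nsq_pos.
  - rewrite nsq_S, (nsq_S u (S n)); unfold shift_adj at 2; lra.
Qed.

(** The partial sums agree up to an index shift by one, since the leading entry of [shift v] is
    zero. *)
Lemma adjoint_shift : adjoint_maps shift shift_adj.
Proof.
  intros u v Hu Hv; apply is_Clim_unique.
  apply is_Clim_ext with (fun n => psum u (shift v) (S n)).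
  - intro n; induction n.
    + unfold psum; simpl; rewrite Cconj_0; ring.
    + change (psum u (shift v) (S n) + u (S n) * Cconj (v n)
              = psum (shift_adj u) v n + u (S n) * Cconj (v n))%K.
      rewrite IHn; reflexivity.
  - apply is_Clim_incr_1, ip_lim; [assumption|].
    apply bounded_map_summable; [apply bounded_shift|assumption].
Qed.

Lemma bounded_id : bounded_map (fun u => u).
Proof. exists 1; split; [lra|intros; rewrite Rmult_1_l; apply nsq_le_ip; assumption]. Qed.

Lemma bounded_zero : bounded_map (fun _ _ => C0).
Proof.
  exists 0; split; [lra|intros u n _]; rewrite nsq_zero; lra.
Qed.

Lemma bounded_add T U :
  bounded_map T -> bounded_map U -> bounded_map (fun u => vadd (T u) (U u)).
Proof.
  intros [B [Bp HB]] [B' [Bp' HB']]; exists (2 * B + 2 * B'); split; [lra|].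
  intros u n Hu; pose proof (nsq_add (T u) (U u) n); pose proof (HB u n Hu);
    pose proof (HB' u n Hu); lra.
Qed.

Lemma bounded_scal c T : bounded_map T -> bounded_map (fun u => vscal c (T u)).
Proof.
  intros [B [Bp HB]]; exists (Cnorm2 c * B); split.
  - apply Rmult_le_pos; [apply Cnorm2_pos|assumption].
  - intros u n Hu; rewrite nsq_scal, Rmult_assoc.
    apply Rmult_le_compat_l; [apply Cnorm2_pos|auto].
Qed.

Lemma bounded_comp T U : bounded_map T -> bounded_map U -> bounded_map (fun u => T (U u)).
Proof.
  intros [B [Bp HB]] HU; pose proof HU as [B' [Bp' HB']].
  exists (B * B'); split; [apply Rmult_le_pos; assumption|intros u n Hu].
  assert (summable (U u)) by (apply bounded_map_summable; assumption).
  eapply Rle_trans; [apply HB; assumption|].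
  rewrite Rmult_assoc; apply Rmult_le_compat_l; [assumption|].
  apply ip_le; [assumption|intro; apply HB'; assumption].
Qed.

Lemma ip_add_r u v w :
  summable u -> summable v -> summable w -> ip u (vadd v w) = (ip u v + ip u w)%K.
Proof.
  intros; rewrite (ip_conj (vadd v w) u), ip_add_l, Cconj_add, <- !ip_conj;
    auto using summable_add.
Qed.

Lemma ip_scal_r c u v :
  summable u -> summable v -> ip u (vscal c v) = (Cconj c * ip u v)%K.
Proof.
  intros; rewrite (ip_conj (vscal c v) u), ip_scal_l, Cconj_mul, <- !ip_conj;
    auto using summable_scal.
Qed.

(** The three claims need one induction: the adjoint identity for sums and products uses that images
    stay summable, and a star exchanges the two maps. *)
Lemma pi0_bounded_adjoint t :
  bounded_map (pi0 t) /\ bounded_map (pi0a t) /\ adjoint_maps (pi0 t) (pi0a t).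
Proof.
  induction t as [| | |a [A1 [A2 A3]] b [B1 [B2 B3]]|c a [A1 [A2 A3]]
    |a [A1 [A2 A3]] b [B1 [B2 B3]]|a [A1 [A2 A3]]].
  - split; [apply bounded_shift|split; [apply bounded_shift_adj|apply adjoint_shift]].
  - split; [apply bounded_id|split; [apply bounded_id|intros u v _ _; reflexivity]].
  - split; [apply bounded_zero|split; [apply bounded_zero|intros u v Hu Hv]].
    change (ip (fun _ => C0) v = ip u (fun _ => C0)).
    (* Zero is written as a multiple of [u] and of [v], so that sesquilinearity evaluates both
       sides. *)
    replace (fun _ : nat => C0) with (vscal C0 u) at 1 by (extensionality n; unfold vscal; ring).
    replace (fun _ : nat => C0) with (vscal C0 v) by (extensionality n; unfold vscal; ring).
    rewrite ip_scal_l, ip_scal_r, Cconj_0 by assumption; ring.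
  - rewrite pi0_tadd, pi0a_tadd.
    split; [apply (bounded_add _ _ A1 B1)|split; [apply (bounded_add _ _ A2 B2)|]].
    intros u v Hu Hv.
    change (ip (vadd (pi0a a u) (pi0a b u)) v = ip u (vadd (pi0 a v) (pi0 b v))).
    rewrite ip_add_l, ip_add_r, A3, B3; auto using bounded_map_summable.
  - rewrite pi0_tscal, pi0a_tscal.
    split; [apply (bounded_scal c _ A1)|split; [apply (bounded_scal _ _ A2)|]].
    intros u v Hu Hv.
    change (ip (vscal (Cconj c) (pi0a a u)) v = ip u (vscal c (pi0 a v))).
    rewrite ip_scal_l, ip_scal_r, A3; auto using bounded_map_summable.
  - rewrite pi0_tmul, pi0a_tmul.
    split; [apply (bounded_comp _ _ A1 B1)|split; [apply (bounded_comp _ _ B2 A2)|]].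
    intros u v Hu Hv; rewrite B3, A3; auto using bounded_map_summable.
  - rewrite pi0_tstar, pi0a_tstar; split; [|split]; try assumption.
    apply adjoint_maps_sym; assumption.
Qed.

Definition l2rep (t : term) (u : l2space) : l2space :=
  l2mk (pi0 t (proj1_sig u))
    (bounded_map_summable _ _ (proj1 (pi0_bounded_adjoint t)) (proj2_sig u)).

Lemma l2rep_star_rep : star_rep l2space l2rep.
Proof.
  repeat split.
  - intros a b E v; apply l2_ext; simpl; rewrite (proj1 (pi0_sound a b E)); reflexivity.
  - intro v; apply l2_ext; reflexivity.
  - intro v; apply l2_ext; reflexivity.
  - intros a b v; apply l2_ext; simpl; rewrite pi0_tadd; reflexivity.
  - intros c a v; apply l2_ext; simpl; rewrite pi0_tscal; reflexivity.
  - intros a b v; apply l2_ext; simpl; rewrite pi0_tmul; reflexivity.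
  - intros a u v; simpl; rewrite pi0_tstar.
    apply (pi0_bounded_adjoint a); apply proj2_sig.
  - intros u v; apply l2_ext; simpl; apply (proj1 (pi0_linear a)).
  - intros c u; apply l2_ext; simpl; apply (proj1 (pi0_linear a)).
  - destruct (pi0_bounded_adjoint a) as [Ba _]; pose proof Ba as [B [Bp HB]].
    exists (sqrt B); intro v; unfold hs_norm; simpl; rewrite <- sqrt_mult_alt by assumption.
    apply sqrt_le_1_alt, ip_le.
    + apply bounded_map_summable; [assumption|apply proj2_sig].
    + intro; apply HB, proj2_sig.
Qed.

(** * The implications between the three conditions *)

Lemma pos_rep_pos_on_l2 x : pos_op l2space (l2rep x) -> pos_on_l2 (pi0 x).
Proof.
  intros P phi Hphi; apply in_l2_summable in Hphi.
  destruct (P (l2mk phi Hphi)) as [P1 P2]; simpl in P1, P2.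
  destruct (ip_lim (pi0 x phi) phi) as [L1 L2]; [|assumption|].
  - apply bounded_map_summable; [apply pi0_bounded_adjoint|assumption].
  - split.
    + exists (Cre (ip (pi0 x phi) phi)); split; [exact P2|].
      apply infinite_sum_Cre; exact L1.
    + apply infinite_sum_Cim; rewrite <- P1; exact L2.
Qed.

Lemma square_pos_op y (H : HilbertSpace) pi :
  star_rep H pi -> pos_op H (pi (tmul (tstar y) y)).
Proof.
  intros (_ & _ & _ & _ & _ & Hm & Hs & _) v.
  rewrite Hm, Hs; split; [|apply hs_inner_pos].
  pose proof (f_equal Cim (hs_innerC H (pi y v) (pi y v))) as E; simpl in E; lra.
Qed.

Lemma pos_on_l2_psd x m : pos_on_l2 (pi0 x) -> psd m (mat x).
Proof.
  (* Extending [u] by zero makes the series of the quadratic form finite, with sum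
     [qform m (mat x) u]. *)
  intros P u; set (phi := fun n => if (n <? m)%nat then u n else C0).
  assert (Hz : forall n, (m <= n)%nat -> phi n = C0).
  { intros n Hn; unfold phi; rewrite (proj2 (Nat.ltb_ge n m) Hn); reflexivity. }
  assert (Hu : forall n, (n < m)%nat -> phi n = u n).
  { intros n Hn; unfold phi; rewrite (proj2 (Nat.ltb_lt n m) Hn); reflexivity. }
  assert (Hphi : in_l2 phi).
  { apply in_l2_summable; exists (nsq phi m); intro n.
    destruct (Nat.le_gt_cases n m) as [Hn|Hn].
    - apply nsq_mono; assumption.
    - unfold nsq, psum; rewrite (Csum_extend _ m n); [lra|lia|].
      intros; rewrite Hz by lia; ring. }
  destruct (P phi Hphi) as [[r [Hr Sr]] _].
  apply infinite_sum_Cre in Sr.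
  set (z := fun n => (pi0 x phi n * Cconj (phi n))%K) in Sr.
  replace (qform m (mat x) u) with r; [assumption|].
  assert (E : is_lim_seq (fun n => Cre (Csum z n)) (Cre (Csum z m))).
  { apply is_lim_seq_ext_loc with (fun _ => Cre (Csum z m)); [|apply is_lim_seq_const].
    exists m; intros n Hn; rewrite (Csum_extend z m n Hn); [reflexivity|].
    intros; unfold z; rewrite Hz, Cconj_0 by lia; ring. }
  apply is_lim_seq_unique in E, Sr; rewrite E in Sr; injection Sr as <-.
  unfold qform, sform; f_equal; apply Csum_ext; intros i Hi.
  destruct (pi0_local x) as [N HN]; unfold z.
  (* Length [m + N] is long enough for locality in every row [i < m]; the terms from [m] on vanish
     with [phi]. *)
  rewrite (HN phi i (m + N)%nat), Hu by lia.
  rewrite (Csum_extend _ m (m + N)); [|lia|intros; rewrite Hz by lia; ring].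
  rewrite <- Csum_mul_r; apply Csum_ext; intros j Hj; rewrite Hu by assumption; ring.
Qed.

Theorem mainTheorem1 :
  forall x : term, eqA x (tstar x) ->
    ((exists y : term, eqA x (tmul (tstar y) y)) <->
     (forall (H : HilbertSpace) (pi : term -> H -> H), star_rep H pi -> pos_op H (pi x)))
    /\
    ((forall (H : HilbertSpace) (pi : term -> H -> H), star_rep H pi -> pos_op H (pi x)) <->
     pos_on_l2 (pi0 x))
    /\
    ((exists y : term, eqA x (tmul (tstar y) y)) ->
     exists y : term, eqA x (tmul (tstar y) y) /\ lower_triangular (pi0 y)).
Proof.
  intros x Hx.
  assert (I_II : (exists y, eqA x (tmul (tstar y) y)) ->
    forall (H : HilbertSpace) (pi : term -> H -> H), star_rep H pi -> pos_op H (pi x)).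
  { intros [y E] H pi Hpi v; rewrite (proj1 Hpi _ _ E v).
    apply square_pos_op; assumption. }
  assert (II_III : (forall (H : HilbertSpace) (pi : term -> H -> H),
      star_rep H pi -> pos_op H (pi x)) -> pos_on_l2 (pi0 x)).
  { intro P; apply pos_rep_pos_on_l2, P, l2rep_star_rep. }
  (* Triangularity is obtained already from (iii), so the last claim follows by passing from (i)
     through (ii) to (iii) and back. *)
  assert (III_I : pos_on_l2 (pi0 x) ->
    exists y, eqA x (tmul (tstar y) y) /\ lower_triangular (pi0 y)).
  { intro P; apply psd_factorization; [assumption|intro; apply pos_on_l2_psd; assumption]. }
  assert (III_I' : pos_on_l2 (pi0 x) -> exists y, eqA x (tmul (tstar y) y)).
  { intro P; destruct (III_I P) as [y [E _]]; exists y; exact E. }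
  refine (conj (conj I_II _) (conj (conj II_III _) _)); auto.
Qed.
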